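(* Every escaping point in $\partial U$ is connected to $\infty$ by a unique dynamic ray, which consists of escaping points in $\partial U$. That is: for every $\underline{s}\in\Sigma_2$ the dynamic ray $\gamma^\infty_{\underline{s}}\colon\mathbb{R}\to\mathbb{C}$ is a (continuous) curve with $\gamma^\infty_{\underline{s}}(\mathbb{R})\subset \partial U\cap\mathcal{I}(f)$ and $\gamma^\infty_{\underline{s}}(t)\to\infty$ as $t\to-\infty$; and for every $z\in\partial U\cap\mathcal{I}(f)$ there is exactly one $\underline{s}\in\Sigma_2$ with $z\in\gamma^\infty_{\underline{s}}(\mathbb{R})$. Moreover, $\partial U$ is the closure (in $\mathbb{C}$) of these curves, i.e. $\partial U=\overline{\bigcup_{\underline{s}\in\Sigma_2}\gamma^\infty_{\underline{s}}(\mathbb{R})}$.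
   Context: Let $f(z)=z+e^{-z}$, with $n$-th iterate $f^n$, and let $\mathcal{I}(f)=\{z\in\mathbb{C}: f^n(z)\to\infty\}$ be its escaping set; its elements are called escaping points. Let $S=\{z\in\mathbb{C}: |\mathrm{Im}\,z|\le\pi\}$. A Baker domain is a periodic Fatou component on which the iterates converge locally uniformly to $\infty$. Let $U$ be the unique Baker domain of $f$ contained in $S$; it satisfies $f(U)\subset U$ and contains $\mathbb{R}$. $\partial U$ is its boundary in $\mathbb{C}$. Let $\Omega_0=\{z\in S:\mathrm{Im}\,z>0\}$, $\Omega_1=\{z\in S:\mathrm{Im}\,z<0\}$. For $i\in\{0,1\}$ let $\phi_i\colon S\setminus[1,+\infty)\to\Omega_i$ be the inverse branch of $f$: $\phi_i(w)$ is the unique $z\in\Omega_i$ with $f(z)=w$. Let $\Sigma_2$ be the set of sequences $\underline{s}=(s_n)_{n\ge0}$ with $s_n\in\{0,1\}$, $\sigma$ the shift map on $\Sigma_2$, and $F(t)=t-e^{-t}$ for $t\in\mathbb{R}$. Dynamic rays. For $t\le-2$, $\underline{s}\in\Sigma_2$, $n\ge0$, let $D^{t,\underline{s}}_n$ be the open square of side length $\pi$ given by $F^n(t)-\pi<\mathrm{Re}\,z<F^n(t)$ together with $0<\mathrm{Im}\,z<\pi$ if $s_n=0$, and $-\pi<\mathrm{Im}\,z<0$ if $s_n=1$. The escaping tail $\gamma_{\underline{s}}\colon(-\infty,-2]\to\mathbb{C}$ is defined by letting $\gamma_{\underline{s}}(t)$ be the unique point of $\bigcap_{n\ge0}\phi_{s_0}\circ\dots\circ\phi_{s_n}(\overline{D^{t,\underline{s}}_{n+1}})$.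 The dynamic ray $\gamma^\infty_{\underline{s}}\colon\mathbb{R}\to\mathbb{C}$ is defined by $\gamma^\infty_{\underline{s}}(t)=\phi_{s_0}\circ\dots\circ\phi_{s_{n-1}}(\gamma_{\sigma^n(\underline{s})}(F^n(t)))$ for any $n\ge0$ with $F^n(t)<-2$ (the value does not depend on $n$). *)

(* Defs.v *)
From HB Require Import structures.
From mathcomp Require Import all_boot all_order all_algebra.
From mathcomp Require Import all_classical all_reals all_analysis.
From mathcomp Require Import complex.

Set Implicit Arguments.
Unset Strict Implicit.
Unset Printing Implicit Defensive.

Import Order.TTheory GRing.Theory Num.Theory.
Import numFieldNormedType.Exports.

Local Open Scope classical_set_scope.
Local Open Scope ring_scope.
Local Open Scope complex_scope.

(* The library does not attach the norm topology to the concrete type [R[i]]. *)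
#[non_forgetful_inheritance]
HB.instance Definition _ (R : realType) := NormedModule.copy R[i] R[i]^o.

Section definitions.
Variable R : realType.
Local Notation C := R[i].
Implicit Types (z w : C) (U V W : set C) (t : R) (s : nat -> bool) (n : nat).

Definition boundary U : set C := closure U `\` interior U.

Definition locally_uniform V (h : nat -> C -> C) (g : C -> C) : Prop :=
  forall z, V z -> exists2 W, nbhs z W & {uniform W `&` V, h @ \oo --> g}.

Definition locally_uniform_infty V (h : nat -> C -> C) : Prop :=
  forall z, V z -> exists2 W, nbhs z W &
    forall M : R, \forall n \near \oo,
      forall w, (W `&` V) w -> M < Normc.normc (h n w).

(* Montel's notion of normality, with the constant limit oo allowed; when the
   members of the family are holomorphic on the open set V, so are the finite
   limits g. *)
Definition normal_family V (H : set (C -> C)) : Prop :=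
  forall h : nat -> C -> C, (forall n, H (h n)) ->
  exists2 k : nat -> nat, {homo k : m n / (m < n)%N} &
    (exists g, locally_uniform V (h \o k) g) \/
    locally_uniform_infty V (h \o k).

Definition fatou_set (f : C -> C) : set C :=
  [set z | exists2 V, open_nbhs z V & normal_family V (range (fun n => iter n f))].

Definition fatou_component (f : C -> C) U : Prop :=
  exists2 z, fatou_set f z & U = connected_component (fatou_set f) z.

Definition baker_domain (f : C -> C) U : Prop :=
  [/\ fatou_component f U,
      exists2 p, (0 < p)%N & iter p f @` U `<=` U &
      locally_uniform_infty U (fun n => iter n f)].

Definition escaping_set (f : C -> C) : set C :=
  [set z | Normc.normc (iter n f z) @[n --> \oo] --> +oo].

Definition cexp z : C :=
  (expR (complex.Re z) * cos (complex.Im z)) +i*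
  (expR (complex.Re z) * sin (complex.Im z)).

Definition fexp z : C := z + cexp (- z).

Definition strip : set C := [set z | `|complex.Im z| <= pi].

(* The symbols 0 and 1 are [false] and [true]. *)
Definition Omega (i : bool) : set C :=
  strip `&` [set z | if i then complex.Im z < 0 else 0 < complex.Im z].

(* Only meaningful for w in the strip minus the half-line [1, +oo[, where the
   preimage in Omega i is unique. *)
Definition phi (i : bool) w : C := xget 0 [set z | Omega i z /\ fexp z = w].

Definition shift s : nat -> bool := fun n => s n.+1.

(* phi (s 0) \o ... \o phi (s n.-1) *)
Fixpoint phis n s : C -> C :=
  if n is m.+1 then phi (s 0%N) \o phis m (shift s) else id.

Definition Fexp t : R := t - expR (- t).

Definition square t s n : set C :=
  [set z | iter n Fexp t - pi < complex.Re z < iter n Fexp t /\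
    if s n then - pi < complex.Im z < 0 else 0 < complex.Im z < pi].

(* Only meaningful for t <= -2, where the intersection is a singleton. *)
Definition escaping_tail s t : C :=
  xget 0 (\bigcap_n (phis n.+1 s @` closure (square t s n.+1))).

(* n is an arbitrary index with Fexp^n(t) < -2; the value does not depend on
   the choice. *)
Definition dynamic_ray s t : C :=
  let n := xget 0%N [set n | iter n Fexp t < -2] in
  phis n s (escaping_tail (iter n shift s) (iter n Fexp t)).

End definitions.

Arguments fexp {R} z.
Arguments strip {R}.

(* Main.v *)
Require Import Defs.
From mathcomp Require Import all_boot all_order all_algebra.
From mathcomp Require Import all_classical all_reals all_analysis.
From mathcomp Require Import complex.
From mathcomp Require Import ring lra zify.

(** Why the theorem holds.

    Write z = x + iy, so that f(z) = z + exp(-z) has real part x + exp(-x) cos y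
    and imaginary part y - exp(-x) sin y.  Where x > 0 and cos y > 0 (the set
    [core]) orbits drift to +oo at a speed that depends only on a lower bound
    for cos y.  The complement of the set [expanding] is a slightly larger
    region, mapped by f into the core, while on [expanding] itself |f'| > 1,
    with a uniform lower bound on every half-plane Re z <= M.  The points of
    the strip S whose orbit stays in S are thus of two kinds: those of the
    [basin], whose orbit reaches the core, and those of the [limit_set], whose
    orbit stays in the expanding set.

    The heart of the proof is [pullback_approx].  If z has its orbit in the
    expanding set, the vertical segment that joins f^N(z) to the nearest line
    Im = pi mod 2 pi on one side, and to a point that f maps into the core on
    the other, lies in the expanding set.  This set is backward invariant, so
    the inverse branches pull the segment back to a path through z along which
    every step was a contraction.  An orbit in the expanding set moves to the
    left as long as it is in the right half-plane; it therefore returns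
    infinitely often to some half-plane Re z <= M, where the contraction is
    uniform, and the length of the path tends to 0 as N grows.  Contraction along
    paths follows from the first order expansion of f.  It follows that the limit set
    is the boundary of the basin ([boundary_basin]), and that the points which
    are eventually mapped to the lines Im = pi or Im = -pi, and from there move
    to -oo, are dense in it ([limit_set_line_approx]).

    Rays are handled through a closed condition ([on_ray]): z is the point of
    the ray of s at time t iff the n-th iterate of z lies in the half-strip
    prescribed by s n for all n, and Re f^k(z) lies in [F^k(t) - pi, F^k(t)]
    as soon as F^k(t) <= -2.  Such a point exists by compactness, is unique
    because f expands distances in the left parts of the half-strips, and
    depends continuously on t because the condition is closed.  Conversely, if
    a point z with itinerary s moves to -oo, the times t allowed by the k-th
    condition form nested compact intervals, so z is on the ray of s
    ([itinerary_left_on_ray]).  Escaping points of the limit set do move to -oo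
    ([limit_set_escape_left]), and their itinerary determines s.

    Finally U is the basin ([baker_domain_basin]).  The basin is open, it is
    contained in the Fatou set because the iterates tend to oo locally
    uniformly on it, and it is connected because the inverse branches carry
    connected subsets of the basin to connected subsets.  That U meets the
    basin is again the pullback argument, now modulo 2 pi i since orbits of U
    might leave S between two returns; hence U contains the basin.  If U were
    larger it would contain a point z of the limit set; on a short segment from
    z to a point of the basin the iterates f^(np) stay in S and tend to oo
    uniformly, although their real parts are negative at one end and positive
    at the other, which is impossible. *)

Set Implicit Arguments.
Unset Strict Implicit.
Unset Printing Implicit Defensive.

Import Order.TTheory GRing.Theory Num.Theory.
Import numFieldNormedType.Exports.

Local Open Scope classical_set_scope.
Local Open Scope ring_scope.

Local Notation Re := complex.Re.
Local Notation Im := complex.Im.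
Local Notation "x +i* y" := (complex.Complex x y) : ring_scope.
Local Notation normc := Normc.normc.
Local Notation shift := Defs.shift.

(** * The topology of the complex plane in coordinates *)

Section Plane.
Variable R : realType.
Local Notation C := R[i].
Implicit Types (z w : C) (A : set C).

Lemma complexP z w : Re z = Re w -> Im z = Im w -> z = w.
Proof. by case: z w => [a b] [c d] /= -> ->. Qed.

Lemma ReD z w : Re (z + w) = Re z + Re w. Proof. by case: z; case: w. Qed.
Lemma ImD z w : Im (z + w) = Im z + Im w. Proof. by case: z; case: w. Qed.
Lemma ReB z w : Re (z - w) = Re z - Re w. Proof. by case: z; case: w. Qed.
Lemma ImB z w : Im (z - w) = Im z - Im w. Proof. by case: z; case: w. Qed.
Lemma ReN z : Re (- z) = - Re z. Proof. by case: z. Qed.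
Lemma ImN z : Im (- z) = - Im z. Proof. by case: z. Qed.

Lemma normc_sqrtE z : Normc.normc z = Num.sqrt (Re z ^+ 2 + Im z ^+ 2).
Proof. by case: z. Qed.

Lemma ler_Re_normc z : `|Re z| <= Normc.normc z.
Proof.
rewrite normc_sqrtE -sqrtr_sqr ler_sqrt ?addr_ge0 ?sqr_ge0//.
by rewrite lerDl sqr_ge0.
Qed.

Lemma ler_Im_normc z : `|Im z| <= Normc.normc z.
Proof.
rewrite normc_sqrtE -sqrtr_sqr ler_sqrt ?addr_ge0 ?sqr_ge0//.
by rewrite lerDr sqr_ge0.
Qed.

Lemma ler_normc z : Normc.normc z <= `|Re z| + `|Im z|.
Proof.
rewrite normc_sqrtE -(ger0_norm (addr_ge0 (normr_ge0 (Re z)) (normr_ge0 (Im z)))).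
rewrite -sqrtr_sqr ler_sqrt ?sqr_ge0// sqrrD -!normrX !(ger0_norm (sqr_ge0 _)).
by rewrite lerD2r lerDl mulrn_wge0 ?mulr_ge0.
Qed.

Lemma nbhs_complexP z A : nbhs z A <->
  exists2 e : R, 0 < e & forall w, `|Re w - Re z| < e -> `|Im w - Im z| < e -> A w.
Proof.
split.
  move=> /nbhs_ballP[e /= e0 eA].
  move: e0; rewrite ltcE/= => /andP[/eqP ime re0].
  have er : e = (Re e)%:C%C by apply: complexP; rewrite //= ime.
  exists (Re e / 2) => [|w wx wy]; first by rewrite divr_gt0.
  apply: eA; rewrite /ball/= er (normc_def (z - w)) ltcR.
  rewrite -(normc_sqrtE (z - w)); apply: le_lt_trans (ler_normc _) _.
  rewrite ReB ImB (splitr (Re e)) ltrD// distrC//.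
move=> [e e0 eA]; apply/nbhs_ballP; exists (e%:C%C) => /=.
  by rewrite ltcR.
move=> w; rewrite /ball/= (normc_def (z - w)) ltcR -(normc_sqrtE (z - w)) => zw.
apply: eA; apply: le_lt_trans _ zw; rewrite distrC -?ReB -?ImB.
  exact: ler_Re_normc.
exact: ler_Im_normc.
Qed.

Lemma continuous_Re : continuous (@complex.Re R : C -> R).
Proof.
move=> z A /nbhs_ballP[e /= e0 eA]; apply/nbhs_complexP; exists e => // w zw _.
by apply: eA; rewrite /ball/= distrC.
Qed.

Lemma continuous_Im : continuous (@complex.Im R : C -> R).
Proof.
move=> z A /nbhs_ballP[e /= e0 eA]; apply/nbhs_complexP; exists e => // w _ zw.
by apply: eA; rewrite /ball/= distrC.
Qed.

Lemma cvg_complex T (F : set_system T) (g : T -> C) z : Filter F ->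
  Re (g t) @[t --> F] --> Re z -> Im (g t) @[t --> F] --> Im z ->
  g t @[t --> F] --> z.
Proof.
move=> FF gx gy A /nbhs_complexP[e e0 eA]; rewrite /nbhs/=.
have /cvgrPdist_lt/(_ e e0) gx' := gx.
have /cvgrPdist_lt/(_ e e0) gy' := gy.
near=> t; apply: eA; rewrite distrC; near: t; [exact: gx'|exact: gy'].
Unshelve. all: by end_near. Qed.

Lemma continuous_complex (T : topologicalType) (g : T -> C) (t : T) :
  {for t, continuous (fun u => Re (g u))} ->
  {for t, continuous (fun u => Im (g u))} -> {for t, continuous g}.
Proof. by move=> gx gy; apply: cvg_complex. Qed.

Definition box (a b c d : R) : set C :=
  [set z | a <= Re z <= b /\ c <= Im z <= d].

Lemma compact_box a b c d : compact (box a b c d).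
Proof.
have -> : box a b c d = (fun p : R * R => p.1 +i* p.2) @` (`[a, b] `*` `[c, d]).
  apply/seteqP; split => [z [zx zy]|_ [p [px py] <-]] /=.
    by exists (Re z, Im z); [split => /=; rewrite in_itv|case: z zx zy].
  by split; move: px py; rewrite /= !in_itv.
apply: continuous_compact; last first.
  by apply: compact_setX; exact: segment_compact.
apply: continuous_subspaceT => p; apply: continuous_complex => /=.
  exact: cvg_fst.
exact: cvg_snd.
Qed.

Lemma hausdorff_complex : hausdorff_space C.
Proof. exact: norm_hausdorff. Qed.

(** The closed graph principle: a map with values in a compact set converges to
    [z] as soon as every other point of the compact set has a neighbourhood that
    the map eventually avoids.  It gives the continuity of the inverse branches
    and of the rays from uniqueness statements alone. *)
Lemma compact_separated_cvg T (F : set_system T) (FF : Filter F) (g : T -> C)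
    (K : set C) z : compact K -> (\forall t \near F, K (g t)) ->
  (forall w, K w -> w <> z ->
     exists2 A, nbhs w A & \forall t \near F, ~ A (g t)) ->
  g t @[t --> F] --> z.
Proof.
move=> cK gK sep O zO; rewrite /nbhs/=; apply: contrapT => nO.
pose G := within (fun t => ~ O (g t)) F.
have PG : ProperFilter (g @ G).
  apply: fmap_proper_filter; apply: Build_ProperFilter_ex => B GB.
  apply: contrapT => nB; apply: nO; move: GB; rewrite /G/= /within/=.
  apply: filterS => t h; apply: contrapT => /h Bt.
  by apply: nB; exists t.
have GK : (g @ G) K by apply: filterS gK => t + _.
have [w [Kw cw]] := cK _ PG GK.
have [wz|/(sep w Kw)[A wA nA]] := pselect (w = z).
  have GO : (g @ G) (fun u => ~ O u).
    change (F (fun t => ~ O (g t) -> ~ O (g t))).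
    by apply: filterS gK => t.
  have wO : nbhs w O by rewrite wz; exact: zO.
  by have [u []] := cw _ _ GO wO.
have GA : (g @ G) (fun u => ~ A u).
  change (F (fun t => ~ O (g t) -> ~ A (g t))).
  by apply: filterS nA => t.
by have [u []] := cw _ _ GA wA.
Qed.

End Plane.

(** * Estimates for exp, sin and cos *)

Section RealFacts.
Variable R : realType.
Implicit Types x y t : R.

Lemma MVT_global (f df : R -> R) (a b : R) : a < b ->
  (forall x, is_derive x 1 f (df x)) ->
  exists2 c, a < c < b & f b - f a = df c * (b - a).
Proof.
move=> ab dfx; have [|c] := MVT ab (fun x _ => dfx x).
  by apply: derivable_within_continuous => x _; apply: ex_derive.
by rewrite in_itv/=; exists c.
Qed.

Lemma sin_ltx x : 0 < x -> sin x < x.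
Proof.
move=> x0; have [y yx] := MVT_global x0 (@is_derive_sin R).
have [x1 _|x1 e] := ltP 1 x; first exact: le_lt_trans (sin_le1 _) x1.
have y1 : cos y < 1.
  have p1 := pihalf_ge1 R.
  rewrite -cos0 ltr_cos ?in_itv/= ?lexx ?pi_ge0//; lra.
by move: e; rewrite sin0 !subr0 => ->; rewrite gtr_pMl.
Qed.

Lemma normr_sin_le x : `|sin x| <= `|x|.
Proof.
wlog x0 : x / 0 < x.
  move=> H; have [/H//|x0|<-] := ltgtP 0 x; last by rewrite sin0.
  by rewrite -(normrN x) -(normrN (sin x)) -sinN; apply: H; rewrite oppr_gt0.
have [y yx] := MVT_global x0 (@is_derive_sin R).
by rewrite sin0 !subr0 => ->; rewrite normrM ler_piMl// cos_max.
Qed.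

Lemma one_sub_cos_le x : `|1 - cos x| <= x ^+ 2.
Proof.
wlog x0 : x / 0 < x.
  move=> H; have [/H//|x0|<-] := ltgtP 0 x; last by rewrite cos0 subrr normr0 sqr_ge0.
  by rewrite -(cosN x) -(sqrrN x); apply: H; rewrite oppr_gt0.
have [y /andP[y0 yx]] := MVT_global x0 (@is_derive_cos R).
rewrite cos0 !subr0 distrC => ->; rewrite normrM normrN expr2.
rewrite (gtr0_norm x0); apply: ler_pM => //; first exact: ltW.
by apply: le_trans (normr_sin_le _) _; rewrite gtr0_norm// ltW.
Qed.

Lemma sub_sin_le x : `|x - sin x| <= `|x| ^+ 3.
Proof.
wlog x0 : x / 0 < x.
  move=> H; have [/H//|x0|<-] := ltgtP 0 x; last first.
    by rewrite sin0 subrr normr0 expr0n.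
  rewrite -(normrN x) -(normrN (x - _)) opprB addrC -(opprK (sin x)) -sinN.
  by apply: H; rewrite oppr_gt0.
have d y : is_derive y 1 (fun y => y - sin y : R) (1 - cos y).
  by apply: is_deriveB.
have [y /andP[y0 yx]] := MVT_global x0 d.
rewrite sin0 !subr0 => ->; rewrite normrM (gtr0_norm x0) exprSr.
apply: ler_wpM2r; first exact: ltW.
apply: le_trans (one_sub_cos_le _) _.
by rewrite ler_sqr ?nnegrE; lra.
Qed.

Lemma expR_quad_ub x : `|x| <= 1 / 2 -> `|expR x - 1 - x| <= 2 * x ^+ 2.
Proof.
rewrite ler_norml => /andP[x1 x2]; rewrite ger0_norm; last first.
  by have := expR_ge1Dx x; lra.
have e1 : expR x * (1 - x) <= 1.
  apply: le_trans (_ : expR x * expR (- x) <= 1).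
    by rewrite ler_pM2l ?expR_gt0//; exact: expR_ge1Dx.
  by rewrite expRxMexpNx_1.
have x3 : 0 < 1 - x by lra.
rewrite -(ler_pM2r x3) !mulrBl.
have : 0 <= x ^+ 2 * (1 - 2 * x) by rewrite mulr_ge0 ?sqr_ge0//; lra.
move: e1; set E := expR x * _; move: (sqr_ge0 x); nra.
Qed.

Lemma expR_ge_quad x : 0 <= x -> 1 + x + x ^+ 2 / 2 <= expR x.
Proof.
rewrite le_eqVlt => /predU1P[<-|x0]; first by rewrite expR0 expr0n/= mul0r !addr0.
have d y : is_derive y 1 (fun y => expR y - (y + y ^+ 2 / 2) : R) (expR y - (1 + y)).
  apply: is_deriveB; apply: is_deriveD.
  have -> : (fun y => y ^+ 2 / 2 : R) = (2^-1 \*: (fun y => y ^+ 2)).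
    by apply/funext => u; rewrite /= mulrC.
  by apply: is_derive_eq; rewrite /= /GRing.scale/= !mulr1; lra.
have [y /andP[y0 yx]] := MVT_global x0 d.
rewrite expR0 expr0n/= mul0r !addr0 !subr0 => e.
have : 0 <= (expR y - (1 + y)) * x.
  by apply: mulr_ge0; [rewrite subr_ge0 expR_ge1Dx|exact: ltW].
by rewrite -e; lra.
Qed.

(** Concavity of sin on [0, pi/2] gives sin x >= 2x/pi, and pi <= 4. *)
Lemma sin_ge_half x : 0 <= x <= pi / 2 -> x / 2 <= sin x.
Proof.
have p1 := pihalf_ge1 R; have p2 := pihalf_lt2 R.
move=> /andP[]; rewrite le_eqVlt => /predU1P[<-|x0]; first by rewrite sin0 mul0r.
rewrite le_eqVlt => /predU1P[->|x1]; first by rewrite sin_pihalf; lra.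
have [y /andP[y0 yx]] := MVT_global x0 (@is_derive_sin R).
have [z /andP[z0 zx]] := MVT_global x1 (@is_derive_sin R).
rewrite sin_pihalf sin0 !subr0 => e1 e2.
have c : cos z < cos y by rewrite ltr_cos ?in_itv/=; lra.
have : cos z * (pi / 2 - x) * x <= sin x * (pi / 2 - x).
  by rewrite e2 mulrAC ler_wpM2r ?subr_ge0 ?(ltW x1)// ler_wpM2r ?(ltW c)// ltW.
rewrite -e1 mulrBl mulrBr mul1r => h.
have h2 : x <= sin x * (pi / 2) by move: h; rewrite (mulrC (sin x) x); lra.
have s0 : 0 <= sin x by apply: sin_ge0_pi; lra.
have : sin x * (pi / 2) <= sin x * 2 by rewrite ler_wpM2l// ltW.
lra.
Qed.

Lemma one_sub_cos_ge x : `|x| <= pi -> x ^+ 2 / 8 <= 1 - cos x.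
Proof.
wlog x0 : x / 0 <= x.
  move=> H; have [/H//|x0] := leP 0 x.
  by rewrite -(normrN x) -(cosN x) -(sqrrN x); apply: H; rewrite oppr_ge0 ltW.
rewrite ger0_norm// => xp.
have -> : cos x = cos ((x / 2) *+ 2) by congr cos; rewrite -mulr_natr divfK.
rewrite cos_mulr2n cos2sin2.
have h : x / 2 / 2 <= sin (x / 2) by apply: sin_ge_half; lra.
have : (x / 2 / 2) ^+ 2 <= sin (x / 2) ^+ 2.
  by rewrite ler_sqr// ?nnegrE; lra.
by rewrite !exprMn; lra.
Qed.

End RealFacts.

(** * The map in coordinates and its injectivity on half-strips *)

Section FexpBasics.
Variable R : realType.
Local Notation C := R[i].
Implicit Types z w : C.

Lemma Re_fexp z : Re (fexp z) = Re z + expR (- Re z) * cos (Im z).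
Proof. by rewrite /fexp ReD /= ReN ImN cosN. Qed.

Lemma Im_fexp z : Im (fexp z) = Im z - expR (- Re z) * sin (Im z).
Proof. by rewrite /fexp ImD /= ReN ImN sinN mulrN. Qed.

Definition fexpE := (Re_fexp, Im_fexp).

Lemma fexp_conj z : fexp z^*%C = (fexp z)^*%C.
Proof.
apply: complexP; rewrite ?fexpE; case: z => x y /=.
  by rewrite !cosN.
by rewrite !sinN opprD mulrN.
Qed.

Lemma continuous_fexp : continuous (@fexp R).
Proof.
have ce z : {for z, continuous (fun z : C => expR (- Re z))}.
  apply: (continuous_comp (g := @expR R)); last exact: continuous_expR.
  by apply: continuousN; exact: continuous_Re.
move=> z; apply: continuous_complex.
  rewrite (_ : (fun u => _) = fun u : C => Re u + expR (- Re u) * cos (Im u)); last first.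
    by apply/funext => u; rewrite Re_fexp.
  apply: continuousD; first exact: continuous_Re.
  apply: continuousM; first exact: ce.
  by apply: continuous_comp; [exact: continuous_Im|exact: continuous_cos].
rewrite (_ : (fun u => _) = fun u : C => Im u - expR (- Re u) * sin (Im u)); last first.
  by apply/funext => u; rewrite Im_fexp.
apply: continuousB; first exact: continuous_Im.
apply: continuousM; first exact: ce.
by apply: continuous_comp; [exact: continuous_Im|exact: continuous_sin].
Qed.

Lemma continuous_iter_fexp n : continuous (iter n (@fexp R)).
Proof.
elim: n => [|n IH] z; first exact: cvg_id.
by apply: (continuous_comp (IH z)); exact: continuous_fexp.
Qed.

(** For d = w - z, the derivative along the segment from z to w of Im(f conj d)
    is |d|^2 Im f' = |d|^2 exp(-x) sin y, positive in the open half-strip.  So f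
    takes different values at z and w when the segment is not contained in the
    boundary of the half-strip; on the line Im = pi, f is the increasing map F.
    Only the real axis, which f folds at 0, has to be excluded. *)
Lemma fexp_inj z w : 0 <= Im z <= pi -> 0 <= Im w <= pi ->
  ~ (Im z = 0 /\ Im w = 0) -> fexp z = fexp w -> z = w.
Proof.
case: z w => [x y] [u v] /= hy hv nr e; apply: contrapT => zw.
have [ex ey] : x + expR (- x) * cos y = u + expR (- u) * cos v /\
               y - expR (- x) * sin y = v - expR (- u) * sin v.
  by split; [have := congr1 (@complex.Re R) e|have := congr1 (@complex.Im R) e]; rewrite !fexpE.
clear e.
have [/andP[yp vp]|nn] := boolP ((y == pi) && (v == pi)).
  move: ex; rewrite (eqP yp) (eqP vp) cospi !mulrN1 => ex.
  have [xu|xu|xu] := ltgtP x u; last by apply: zw; rewrite xu (eqP yp) (eqP vp).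
    have : expR (- u) < expR (- x) by rewrite ltr_expR ltrN2.
    by lra.
  have : expR (- x) < expR (- u) by rewrite ltr_expR ltrN2.
  by lra.
pose p := u - x; pose q := v - y.
pose X t := x + t * p; pose Y t := y + t * q.
have dX (t : R) : is_derive t 1 (X : R -> R) p.
  by rewrite /X; apply: is_derive_eq; rewrite /= /GRing.scale/= !mulr1; lra.
have dY (t : R) : is_derive t 1 (Y : R -> R) q.
  by rewrite /Y; apply: is_derive_eq; rewrite /= /GRing.scale/= !mulr1; lra.
have dE (t : R) : is_derive t 1 (expR \o (- X) : R -> R) (- p * expR (- X t)).
  by apply: is_derive_eq; rewrite /= mulrC.
have dS (t : R) : is_derive t 1 (sin \o Y : R -> R) (cos (Y t) * q).
  by apply: is_derive_eq.
have dC (t : R) : is_derive t 1 (cos \o Y : R -> R) (- sin (Y t) * q).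
  by apply: is_derive_eq.
have dh (t : R) : is_derive t 1
   (p \*: (Y - (expR \o (- X)) * (sin \o Y)) - q \*: (X + (expR \o (- X)) * (cos \o Y)) : R -> R)
   ((p ^+ 2 + q ^+ 2) * expR (- X t) * sin (Y t)).
  apply: is_derive_eq; rewrite /= /GRing.scale/=; ring.
have [t /andP[t0 t1]] := MVT_global (@ltr01 R) dh.
have X0 : X 0 = x by rewrite /X mul0r addr0.
have X1 : X 1 = u by rewrite /X /p; lra.
have Y0 : Y 0 = y by rewrite /Y mul0r addr0.
have Y1 : Y 1 = v by rewrite /Y /q; lra.
have -> : (p \*: (Y - (expR \o - X) * (sin \o Y)) -
    q \*: (X + (expR \o - X) * (cos \o Y))) 1 =
    p * (v - expR (- u) * sin v) - q * (u + expR (- u) * cos v).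
  by rewrite -X1 -Y1.
have -> : (p \*: (Y - (expR \o - X) * (sin \o Y)) -
    q \*: (X + (expR \o - X) * (cos \o Y))) 0 =
    p * (y - expR (- x) * sin y) - q * (x + expR (- x) * cos y).
  by rewrite -X0 -Y0.
rewrite ex ey subrr => /esym; apply/eqP; rewrite gt_eqF// subr0 mulr1.
have Yt : 0 < Y t < pi.
  have -> : Y t = (1 - t) * y + t * v by rewrite /Y /q; ring.
  have s0 : 0 < 1 - t by rewrite subr_gt0.
  move: hy hv => /andP[y0 y1] /andP[v0 v1]; apply/andP; split.
    rewrite lt0r addr_ge0 ?mulr_ge0 ?(ltW s0) ?(ltW t0)// andbT.
    apply/eqP => /eqP; rewrite paddr_eq0 ?mulr_ge0 ?(ltW s0) ?(ltW t0)//.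
    rewrite !mulf_eq0 (gt_eqF s0) (gt_eqF t0) /= => /andP[/eqP a /eqP b].
    exact: nr.
  have -> : pi = (1 - t) * pi + t * pi :> R by ring.
  move: nn; rewrite negb_and => /orP[yp|vp].
    by rewrite ltr_leD ?ltr_pM2l ?ler_pM2l// lt_neqAle yp.
  by rewrite ler_ltD ?ltr_pM2l ?ler_pM2l// lt_neqAle vp.
rewrite !mulr_gt0 ?expR_gt0 ?sin_gt0_pi// lt0r addr_ge0 ?sqr_ge0// andbT.
apply/eqP => /eqP; rewrite paddr_eq0 ?sqr_ge0// !sqrf_eq0 => /andP[/eqP p0 /eqP q0].
apply: zw; rewrite /p /q in p0 q0.
by congr (_ +i* _); lra.
Qed.

End FexpBasics.

(** * Surjectivity of the half-strip map *)

Section Surjectivity.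
Variable R : realType.
Local Notation C := R[i].
Implicit Types (z w : C) (a b x y t : R) (i : bool).

Lemma Fexp_lt : {homo @Fexp R : x y / x < y}.
Proof.
move=> x y xy; rewrite /Fexp ltrD// ltrN2 ltr_expR ltrN2//.
Qed.

Lemma continuous_Fexp : continuous (@Fexp R).
Proof.
move=> x; apply: cvgB; first exact: cvg_id.
apply: (continuous_comp (g := @expR R)); last exact: continuous_expR.
by apply: continuousN; exact: cvg_id.
Qed.

Lemma Fexp_surj a : exists t : R, Fexp t = a.
Proof.
have [|||t _ <-] := @IVT R (@Fexp R) a (a + expR (- a)) a.
- by rewrite lerDl expR_ge0.
- exact: continuous_subspaceT continuous_Fexp.
- rewrite ge_min le_max /Fexp; apply/andP; split; apply/orP; [left|right].
    by rewrite gerBl expR_ge0.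
  by rewrite -addrA lerDl subr_ge0 ler_expR lerN2 lerDl expR_ge0.
by exists t.
Qed.

Lemma real_fexp_surj a : 1 <= a -> exists x, x + expR (- x) = a.
Proof.
move=> a1.
have [|||t _ <-] := @IVT R (fun x => x + expR (- x)) 0 a a.
- by apply: le_trans a1.
- apply: continuous_subspaceT => x; apply: cvgD; first exact: cvg_id.
  apply: (continuous_comp (g := @expR R)); last exact: continuous_expR.
  by apply: continuousN; exact: cvg_id.
- rewrite ge_min le_max; apply/andP; split; apply/orP; [left|right].
    by rewrite oppr0 expR0 add0r.
  by rewrite lerDl expR_ge0.
by exists t.
Qed.

(** A point x + iy has image a + ib iff exp(-x) = E b y (by the imaginary part) and
    a = A b y (by the real part); the equation f(z) = a + ib becomes A b y = a. *)
Let E b y := (y - b) / sin y.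
Let A b y := E b y * cos y - ln (E b y).

(** As y tends to pi, E b y tends to +oo while cos y < 0, so A b y tends to -oo. *)
Let A_low b a : b < pi -> exists y, [/\ b < y, 0 < y < pi & A b y <= a].
Proof.
move=> bp; pose d := (pi - b) / 2.
have d0 : 0 < d by rewrite divr_gt0// subr_gt0.
have p1 := pihalf_ge1 R.
(* Then cos y <= 0 and E b y >= d / h >= exp(-a) at y = pi - h. *)
pose h := Num.min (pi / 2) (Num.min d (d * expR a)).
have h0 : 0 < h by rewrite !lt_min d0 (mulr_gt0 d0 (expR_gt0 _)) !andbT; lra.
have h1 : h <= pi / 2 by rewrite ge_min lexx.
have h2 : h <= d by rewrite !ge_min lexx orbT.
have h3 : h <= d * expR a by rewrite !ge_min lexx !orbT.
have sE : sin (pi - h) = sin h by rewrite sinB sinpi cospi; ring.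
have s0 : 0 < sin (pi - h) by apply: sin_gt0_pi; lra.
exists (pi - h); split; [rewrite /d in h2; lra|lra|].
have dy : d <= pi - h - b by rewrite /d in h2 *; lra.
have sh : sin (pi - h) <= d * expR a by rewrite sE; apply: le_trans h3; exact/ltW/sin_ltx.
have Ea : expR (- a) <= E b (pi - h).
  rewrite /E ler_pdivlMr//; apply: le_trans dy.
  apply: le_trans (ler_wpM2l (expR_ge0 _) sh) _.
  by rewrite mulrCA (mulrC (expR _)) expRxMexpNx_1 mulr1.
have E0 : 0 < E b (pi - h) by apply: lt_le_trans (expR_gt0 _) Ea.
have l : - a <= ln (E b (pi - h)) by rewrite -(expRK (- a)) ler_ln ?posrE ?expR_gt0.
have c : cos (pi - h) <= 0.
  rewrite cosB sinpi cospi mul0r addr0 mulN1r oppr_le0.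
  by apply: cos_ge0_pihalf; lra.
have := mulr_ge0_le0 (ltW E0) c; rewrite /A; lra.
Qed.

(** At the lower end of the admissible y: for b < 0, E b y tends to +oo with
    cos y near 1; for b > 0, E b y tends to 0; for b = 0, A b y tends to 1, which
    is where the slit [1, +oo[ comes from. *)
Let A_up b a : b < pi -> (b = 0 -> a < 1) ->
  exists y, [/\ b < y, 0 < y < pi & a <= A b y].
Proof.
move=> bp b1.
have p1 := pihalf_ge1 R.
have [b0|b0|b0] := ltgtP b 0.
(* Case b < 0: E b h >= - b / h is large, and A b h >= E / 2 - ln E. *)
- pose h := Num.min (1 / 2) (- b / (4 * (`|a| + 2))).
  have k0 : 0 < 4 * (`|a| + 2) by rewrite mulr_gt0// ltr_wpDl.
  have h0 : 0 < h by rewrite lt_min !divr_gt0// oppr_gt0.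
  have h1 : h <= 1 / 2 by rewrite ge_min lexx.
  have h2 : h <= - b / (4 * (`|a| + 2)) by rewrite !ge_min lexx orbT.
  have s0 : 0 < sin h by apply: sin_gt0_pi; lra.
  exists h; split; [lra|lra|].
  have c : 1 / 2 <= cos h.
    have := one_sub_cos_le h; rewrite ler_norml => /andP[_].
    have : h ^+ 2 <= (1 / 2) ^+ 2 by rewrite ler_sqr ?nnegrE; lra.
    rewrite expr2; lra.
  have Ek : 4 * (`|a| + 2) <= E b h.
    rewrite /E ler_pdivlMr//.
    apply: le_trans (_ : 4 * (`|a| + 2) * h <= _).
      by rewrite ler_pM2l//; exact/ltW/sin_ltx.
    move: h2; rewrite ler_pdivlMr// mulrC; lra.
  have E0 : 0 < E b h by apply: lt_le_trans Ek.
  have l : ln (E b h) <= E b h / 4 + 2.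
    have -> : ln (E b h) = ln (E b h / 4) + ln 4.
      rewrite -lnM ?posrE//; last by rewrite divr_gt0.
      by congr ln; rewrite -mulrA mulVf ?mulr1// pnatr_eq0.
    have := ln_sublinear (_ : 0 < E b h / 4); rewrite divr_gt0// => /(_ isT).
    have : ln 4 <= 2 :> R.
      rewrite -[leRHS]expRK ler_ln ?posrE ?expR_gt0//.
      have := expR_ge_quad (_ : (0 : R) <= 2); rewrite ler0n => /(_ isT).
      rewrite expr2; lra.
    lra.
  have : E b h * (1 / 2) <= E b h * cos h by rewrite ler_pM2l.
  have := ler_norm a; rewrite /A; lra.
- pose s := sin b.
  have s0 : 0 < s by apply: sin_gt0_pi; rewrite b0.
  (* Case b > 0: sin stays above s / 2 on [b, b + h], so E is at most exp(-a - 1). *)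
  pose h := Num.min (s / 2) (Num.min ((pi - b) / 2) (s / 2 * expR (- a - 1))).
  have h0 : 0 < h by rewrite !lt_min ?mulr_gt0 ?expR_gt0 ?invr_gt0 ?subr_gt0.
  have h1 : h <= s / 2 by rewrite ge_min lexx.
  have h2 : h <= (pi - b) / 2 by rewrite !ge_min lexx orbT.
  have h3 : h <= s / 2 * expR (- a - 1) by rewrite !ge_min lexx !orbT.
  exists (b + h); split; [lra|lra|].
  have sh : s / 2 <= sin (b + h).
    have bh : b < b + h by rewrite ltrDl.
    have [y _] := MVT_global bh (@is_derive_sin R).
    have -> : b + h - b = h by lra.
    move=> e; have : - 1 * h <= cos y * h by rewrite ler_pM2r// cos_geN1.
    rewrite -e -/s; lra.
  have sp : 0 < sin (b + h) by apply: lt_le_trans sh; rewrite divr_gt0.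
  have EE : E b (b + h) = h / sin (b + h) by rewrite /E addrAC subrr add0r.
  have E0 : 0 < E b (b + h) by rewrite EE divr_gt0.
  have E1 : E b (b + h) <= 1 by rewrite EE ler_pdivrMr// mul1r; lra.
  have E2 : E b (b + h) <= expR (- a - 1).
    rewrite EE ler_pdivrMr//; apply: le_trans h3 _.
    by rewrite mulrC ler_pM2l ?expR_gt0.
  have l : ln (E b (b + h)) <= - a - 1.
    by rewrite -[leRHS]expRK ler_ln ?posrE ?expR_gt0.
  have : E b (b + h) * - 1 <= E b (b + h) * cos (b + h).
    by rewrite ler_pM2l// cos_geN1.
  rewrite /A; lra.
- have {b1}a1 := b1 b0; subst b.
  (* Case b = 0: A 0 h >= 1 - E (1 - cos h) with 1 <= E <= 2. *)
  pose h := Num.min (1 / 2) ((1 - a) / 2).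
  have h0 : 0 < h by rewrite lt_min !divr_gt0// subr_gt0.
  have h1 : h <= 1 / 2 by rewrite ge_min lexx.
  have h2 : h <= (1 - a) / 2 by rewrite !ge_min lexx orbT.
  have s0 : 0 < sin h by apply: sin_gt0_pi; lra.
  have sh : h / 2 <= sin h by apply: sin_ge_half; lra.
  exists h; split; [lra|lra|].
  have EE : E 0 h = h / sin h by rewrite /E subr0.
  have E0 : 0 < E 0 h by rewrite EE divr_gt0.
  have E2 : E 0 h <= 2 by rewrite EE ler_pdivrMr//; lra.
  have l : ln (E 0 h) <= E 0 h - 1.
    have -> : ln (E 0 h) = ln (1 + (E 0 h - 1)) by congr ln; ring.
    by apply: le_ln1Dx; lra.
  have := one_sub_cos_le h; rewrite ler_norml => /andP[_ c].
  have c0 : 0 <= 1 - cos h by rewrite subr_ge0 cos_le1.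
  have : E 0 h * (1 - cos h) <= 2 * h ^+ 2 by rewrite ler_pM// ltW.
  have : h ^+ 2 <= h * (1 / 2) by rewrite expr2 ler_pM2l.
  rewrite /A; lra.
Qed.

Lemma fexp_surj_upper w : Im w <= pi -> (Im w = 0 -> Re w < 1) ->
  exists z, 0 < Im z <= pi /\ fexp z = w.
Proof.
case: w => a b /=; rewrite le_eqVlt => /predU1P[->{b} _|bp b1].
  have [t ta] := Fexp_surj a; exists (t +i* pi); split.
    by rewrite /= lexx pi_gt0.
  by apply: complexP; rewrite fexpE/= ?sinpi ?cospi -?ta /Fexp; lra.
have [u [bu u0 Au]] := A_up bp b1.
have [v [bv v0 Av]] := A_low a bp.
have cA y : b < y -> 0 < y < pi -> {for y, continuous (A b)}.
  move=> b_y y0.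
  have s0 : 0 < sin y by exact: sin_gt0_pi.
  have cE : {for y, continuous (E b)}.
    apply: continuousM.
      by apply: continuousB; [exact: cvg_id|exact: cvg_cst].
    by apply: continuousV; [rewrite gt_eqF|exact: continuous_sin].
  apply: continuousB; first by apply: continuousM => //; exact: continuous_cos.
  apply: (continuous_comp cE); apply: continuous_ln.
  by rewrite divr_gt0// subr_gt0.
pose m := Num.min u v; pose M := Num.max u v.
have mM : m <= M by rewrite /m /M ge_min le_max lexx.
have inI y : m <= y <= M -> b < y /\ 0 < y < pi.
  rewrite /m /M ge_min le_max => /andP[/orP[my|my] /orP[yM|yM]]; lra.
have [||y] := @IVT R (A b) m M a mM.
- apply: continuous_in_subspaceT => y; rewrite inE/= in_itv/= => /inI[b_y y0].
  exact: cA.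
- rewrite /m /M; have [uv|uv] := leP u v; rewrite ge_min le_max Au Av ?orbT//.
rewrite in_itv/= => /inI[b_y y0] Aa.
have s0 : 0 < sin y by exact: sin_gt0_pi.
have E0 : 0 < E b y by rewrite divr_gt0// subr_gt0.
exists ((- ln (E b y)) +i* y); split => /=; first lra.
apply: complexP; rewrite fexpE/= opprK lnK ?posrE//.
  by rewrite -Aa /A; ring.
by rewrite /E divfK ?gt_eqF//; ring.
Qed.

End Surjectivity.

(** * The inverse branches and their continuity *)

Section InverseBranches.
Variable R : realType.
Local Notation C := R[i].
Implicit Types (z w : C) (a b x y t : R) (i : bool).

(** The distance to the real axis, signed so that it is positive in the half-strip
    of the symbol [i]; it lets both half-strips be treated at once. *)
Definition height i z : R := if i then - Im z else Im z.
Definition halfstrip i : set C := [set z | 0 <= height i z <= pi].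
(** The half-plane bounded by the outer line of the half-strip [i], minus the slit.
    It is larger than the slit strip: this is needed for orbits that leave S. *)
Definition branch_domain i : set C :=
  [set w | height i w <= pi /\ (Im w = 0 -> Re w < 1)].

Lemma OmegaE i z : Omega i z <-> 0 < height i z <= pi.
Proof.
rewrite /Omega /strip /height /=; split.
  by case: i => -[]; rewrite ler_norml => /andP[h1 h2] h3; apply/andP; split; lra.
by case: i => /andP[h1 h2]; split; rewrite ?ler_norml; lra.
Qed.

Lemma Omega_halfstrip i : Omega i `<=` halfstrip i.
Proof. by move=> z /OmegaE /andP[/ltW h1 h2]; apply/andP. Qed.

Lemma halfstrip_Omega i z : halfstrip i z -> Im z <> 0 -> Omega i z.
Proof.
move=> /andP[h1 h2] z0; apply/OmegaE; rewrite h2 andbT lt_neqAle h1 andbT.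
by apply/eqP => h; apply: z0; move: h; rewrite /height; case: i {h1 h2}; lra.
Qed.

Lemma halfstrip_strip i : halfstrip i `<=` strip.
Proof.
move=> z /andP[]; rewrite /strip/= ler_norml /height; have := pi_ge0 R.
by case: i; lra.
Qed.

Lemma closed_halfstrip i : closed (halfstrip i).
Proof.
have -> : halfstrip i = height i @^-1` `[0, pi].
  by apply/seteqP; split => z; rewrite /= in_itv.
apply: closed_comp; last exact: itv_closed.
move=> z _; rewrite /height; case: i; last exact: continuous_Im.
by apply: continuousN; exact: continuous_Im.
Qed.

Lemma height_real i z : (height i z = 0) <-> (Im z = 0).
Proof. by rewrite /height; case: i; lra. Qed.

Let flip i z := if i then z^*%C else z.
Let flipK i : involutive (flip i).
Proof. by case: i => // z; rewrite /flip conjcK. Qed.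
Let Re_flip i z : Re (flip i z) = Re z.
Proof. by case: i; case: z. Qed.
Let Im_flip i z : Im (flip i z) = height i z.
Proof. by case: i; case: z. Qed.
Let height_flip i z : height i (flip i z) = Im z.
Proof. by rewrite -Im_flip flipK. Qed.
Let fexp_flip i z : fexp (flip i z) = flip i (fexp z).
Proof. by case: i => //; rewrite /flip fexp_conj. Qed.

Lemma height_fexp i z :
  height i (fexp z) = height i z - expR (- Re z) * sin (height i z).
Proof. by rewrite -!Im_flip -fexp_flip Im_fexp Re_flip. Qed.

Lemma cos_height i z : cos (height i z) = cos (Im z).
Proof. by case: i => //=; rewrite /height cosN. Qed.

Lemma halfstrip_fexp_inj i z w : halfstrip i z -> halfstrip i w ->
  ~ (Im z = 0 /\ Im w = 0) -> fexp z = fexp w -> z = w.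
Proof.
rewrite /halfstrip/= -!Im_flip => hz hw nr e.
rewrite -(flipK i z) -(flipK i w); congr flip.
apply: fexp_inj => //; last by rewrite !fexp_flip e.
by rewrite !Im_flip => -[/height_real z0 /height_real w0]; exact: nr.
Qed.

Lemma phiP i w : branch_domain i w -> Omega i (phi i w) /\ fexp (phi i w) = w.
Proof.
move=> [wp w1].
suff [z zP] : exists z, Omega i z /\ fexp z = w by exact: (@xgetPex C 0 [set z | Omega i z /\ fexp z = w] (ex_intro _ z zP)).
have [||z [z0 zw]] := @fexp_surj_upper R (flip i w).
- by rewrite Im_flip.
- by rewrite Im_flip Re_flip => /height_real.
exists (flip i z); split; first by apply/OmegaE; rewrite height_flip.
by rewrite fexp_flip zw flipK.
Qed.

Lemma phi_Omega i w : branch_domain i w -> Omega i (phi i w).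
Proof. by move=> /phiP[]. Qed.

Lemma fexpK i w : branch_domain i w -> fexp (phi i w) = w.
Proof. by move=> /phiP[]. Qed.

Lemma Omega_nonreal i z : Omega i z -> Im z <> 0.
Proof. by move=> /OmegaE + z0; rewrite /height; case: i; rewrite z0; lra. Qed.

(** A value in the slit is already taken at a real point, so injectivity on the
    closed half-strip forbids it. *)
Lemma Omega_branch_domain i z : Omega i z -> branch_domain i (fexp z).
Proof.
move=> zi; have zh := Omega_halfstrip zi; split.
  rewrite height_fexp; move: zh => /andP[h0 h1].
  suff : 0 <= expR (- Re z) * sin (height i z) by lra.
  by rewrite mulr_ge0 ?expR_ge0// sin_ge0_pi// h0.
move=> i0; rewrite ltNge; apply/negP => /real_fexp_surj[x xE].
have : fexp z = fexp (x +i* 0).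
  apply: complexP; rewrite [RHS]fexpE /=; first by rewrite cos0 mulr1 xE.
  by rewrite sin0 mulr0 subr0.
move=> e; apply: (Omega_nonreal zi).
have -> : z = x +i* 0; last by [].
apply: (halfstrip_fexp_inj zh) => //.
  by rewrite /halfstrip/= /height /=; case: (i); rewrite ?oppr0 lexx pi_ge0.
by move=> [/(Omega_nonreal zi)].
Qed.

Lemma phi_eq i z w : Omega i z -> fexp z = w -> phi i w = z.
Proof.
move=> zi zw; have [pw pwE] := phiP (Omega_branch_domain zi).
rewrite -zw; apply: (@halfstrip_fexp_inj i) => //; try exact: Omega_halfstrip.
by move=> [_ /(Omega_nonreal zi)].
Qed.

Lemma Omega_inj i z w : Omega i z -> Omega i w -> fexp z = fexp w -> z = w.
Proof. by move=> zi wi e; rewrite -(phi_eq zi e) (phi_eq wi). Qed.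

Lemma expR_le_dist z : expR (- Re z) <=
  `|Re (fexp z) - Re z| + `|Im (fexp z) - Im z|.
Proof.
rewrite !fexpE; set e := expR _; have e0 : 0 < e := expR_gt0 _.
rewrite addrAC subrr add0r addrAC subrr add0r normrN !normrM (gtr0_norm e0).
rewrite -mulrDr ler_peMr ?(ltW e0)// -(cos2Dsin2 (Im z)).
have sq (c : R) : `|c| <= 1 -> c ^+ 2 <= `|c|.
  by move=> c1; rewrite -(ger0_norm (sqr_ge0 c)) normrX expr2 ler_piMl.
by apply: lerD; apply: sq; rewrite ?cos_max ?sin_max.
Qed.

(** If Re z is very negative then |f(z) - z| = exp(- Re z) dominates |Re z|, and if
    Re z is large then f(z) is within 1 of z: f is proper on the strip. *)
Lemma strip_Re_bound z : strip z ->
  `|Re z| <= `|Re (fexp z)| + `|Im (fexp z)| + 10.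
Proof.
rewrite /strip/= => zS; have p4 := pihalf_lt2 R.
have := expR_le_dist z.
have := ler_norm (Re (fexp z)); have := normr_ge0 (Im (fexp z)).
have := ler_normB (Re (fexp z)) (Re z); have := ler_normB (Im (fexp z)) (Im z).
have [x0|x0] := leP 0 (Re z).
  rewrite (ger0_norm x0) => _ _ i0 r0 _.
  suff : Re z - 1 <= Re (fexp z) by lra.
  rewrite Re_fexp lerD2l.
  have e1 : expR (- Re z) <= 1 by rewrite expR_le1 oppr_le0.
  have := cos_geN1 (Im z); have := expR_ge0 (- Re z).
  move: (expR _) (cos _) e1 => e c; nra.
rewrite (ltr0_norm x0) => h1 h2 i0 r0.
have := expR_ge_quad (_ : 0 <= - Re z); rewrite oppr_ge0 => /(_ (ltW x0)).
move: (normr_ge0 (Re (fexp z))) (sqr_ge0 (Re z + 2)) => r1.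
rewrite sqrrN !expr2; lra.
Qed.

(** The branch stays in a compact box by [strip_Re_bound], and any limit point in
    the closed half-strip has image w0, hence is [phi i w0] by injectivity. *)
Lemma phi_continuous i w0 : branch_domain i w0 ->
  phi i w @[w --> within (branch_domain i) (nbhs w0)] --> phi i w0.
Proof.
move=> d0.
pose M := `|Re w0| + `|Im w0| + 12.
apply: (@compact_separated_cvg _ _ _ _ _ (box (- M) M (- pi) pi)).
- exact: compact_box.
- apply/nbhs_complexP; exists 1; first by [].
  move=> w w1 w2 dw; have [pw pwE] := phiP dw.
  have pS := halfstrip_strip (Omega_halfstrip pw).
  have := strip_Re_bound pS; rewrite pwE.
  have := ler_norm (`|Re w| - `|Re w0|); have := ler_norm (`|Im w| - `|Im w0|).
  have := ler_dist_dist (Re w) (Re w0); have := ler_dist_dist (Im w) (Im w0).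
  move: pS; rewrite /box/= /strip/= !ler_norml /M.
  move=> pS h1 h2 h3 h4 h5; split=> //; lra.
- move=> z _ zw0.
  have [zi|zi] := pselect (halfstrip i z); last first.
    exists (~` halfstrip i).
      by apply: open_nbhs_nbhs; split => //; exact/closed_openC/closed_halfstrip.
    rewrite nearE /within/=; apply: nearW => w dw.
    by move/(_ (Omega_halfstrip (phi_Omega dw))).
  have fzw : fexp z <> w0.
    move=> fz; apply: zw0; have [p pE] := phiP d0.
    apply: (halfstrip_fexp_inj zi (Omega_halfstrip p)); last by rewrite pE.
    by move=> [_ /(Omega_nonreal p)].
  have [[U V] /= [zU wV] UV] : exists2 AB, nbhs (fexp z) AB.1 /\ nbhs w0 AB.2 &
      AB.1 `&` AB.2 = set0.
    apply: contrapT => nH; apply: fzw; apply: hausdorff_complex => A B nA nB.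
    apply: contrapT => /set0P/negP/negPn/eqP AB; apply: nH.
    by exists (A, B).
  exists (fexp @^-1` U); first exact: continuous_fexp.
  apply: filterS wV => w Vw dw; rewrite /preimage/= fexpK// => Uw.
  by have : (U `&` V) w by []; rewrite UV.
Qed.

End InverseBranches.

(** * The attracting core and the expanding set *)

Section Core.
Variable R : realType.
Local Notation C := R[i].
Implicit Types (z w : C) (a b x y t : R) (i : bool).

(** A union of half-strips, the components of which are the translates of
    {x > 0, |y| < pi/2} by the periods; real parts increase on it. *)
Definition core : set C := [set z | 0 < Re z /\ 0 < cos (Im z)].

(** The constant 1/2 only has to be positive and small enough for [left_core]; it
    keeps the set, where Re z <= 0, away from the curve |1 - exp(-z)| = 1 on which
    |f'| = 1. *)
Definition expanding : set C :=
  [set z | (0 < Re z -> cos (Im z) <= 0) /\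
           (Re z <= 0 -> 2 * cos (Im z) + 1 / 2 <= expR (- Re z))].

Lemma cosK_itv y : -1 <= cos y <= 1.
Proof. by rewrite cos_geN1 cos_le1. Qed.

(** The imaginary part y - e sin y may be computed with y reduced to [0, pi], as
    its cosine is even and periodic in y. *)
Lemma cos_sub_sin_acos y e :
  cos (y - e * sin y) = cos (acos (cos y) - e * sin (acos (cos y))).
Proof.
have cy := cosK_itv y.
rewrite !cosB acosK ?in_itv//= sin_acos// -sin2cos2 sqrtr_sqr; congr (_ + _).
  by congr (_ * _); have [s0|s0] := ger0P (sin y); rewrite ?mulrN ?cosN.
by have [s0|s0] := ger0P (sin y); rewrite // mulrN sinN mulrNN.
Qed.

(** With y reduced to [0, pi/2], the new angle y - exp(-x) sin y is in [0, y]. *)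
Lemma cos_step_ge x y : 0 < x -> 0 <= cos y ->
  cos y <= cos (y - expR (- x) * sin y) /\ 0 < cos (y - expR (- x) * sin y).
Proof.
move=> x0 c0; rewrite cos_sub_sin_acos.
have cy := cosK_itv y; have p1 := pihalf_ge1 R.
rewrite -{1}[cos y]acosK ?in_itv//=.
have v0 : 0 <= acos (cos y) by apply: acos_ge0.
have v1 : acos (cos y) <= pi / 2.
  rewrite leNgt; apply/negP => vp.
  have := acos_lepi cy; rewrite leNgt => /negP; apply.
  have : cos (acos (cos y)) < cos (pi / 2).
    by rewrite ltr_cos ?in_itv/= ?acos_ge0 ?acos_lepi//; lra.
  by rewrite acosK ?in_itv//= cos_pihalf; lra.
move: (acos _) v0 v1 => v v0 v1 {c0 cy}.
have e0 := expR_gt0 (- x).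
have e1 : expR (- x) < 1 by rewrite expR_lt1; lra.
have s0 : 0 <= sin v by apply: sin_ge0_pi; lra.
have es0 : 0 <= expR (- x) * sin v by rewrite mulr_ge0// ltW.
have [v00|v00] := eqVneq v 0.
  by rewrite v00 sin0 mulr0 subr0 cos0 lexx ltr01.
have vp : 0 < v by rewrite lt_neqAle eq_sym v00.
have sv : 0 < sin v by apply: sin_gt0_pi; lra.
have es1 : expR (- x) * sin v < sin v by rewrite gtr_pMl.
have es2 : 0 < expR (- x) * sin v by rewrite mulr_gt0.
have sl := sin_ltx vp.
split.
  apply: ltW; rewrite ltr_cos ?in_itv/=; lra.
by apply: cos_gt0_pihalf; lra.
Qed.

Lemma core_step z : core z ->
  [/\ core (fexp z), Re z <= Re (fexp z) & cos (Im z) <= cos (Im (fexp z))].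
Proof.
move=> [x0 c0]; have [c1 c2] := cos_step_ge x0 (ltW c0).
have ec : 0 < expR (- Re z) * cos (Im z) by rewrite mulr_gt0// expR_gt0.
by rewrite /core /= !fexpE; split; [split|..] => //; lra.
Qed.

(** The strict conclusion also holds on the edge cos y = 0 of the core; there the
    vertical segments of [expanding_segment] end. *)
Lemma boundary_core z : 0 < Re z -> cos (Im z) = 0 -> core (fexp z).
Proof.
move=> x0 c0; have [_] := cos_step_ge x0 (eq_ind_r (fun c => 0 <= c) (lexx _) c0).
by rewrite /core /= !fexpE c0 mulr0 addr0.
Qed.

(** Put r = exp(-x) >= 1.  Then x >= 1 - r, so the new real part is at least
    1 - r + r(r/2 - 1/4), a quadratic without real roots; the new angle lies
    between -1 and pi/2 because r sin y - y <= 2 sin y cos y <= 1. *)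
Lemma left_core z : Re z <= 0 -> expR (- Re z) <= 2 * cos (Im z) + 1 / 2 ->
  core (fexp z).
Proof.
rewrite /core /= !fexpE cos_sub_sin_acos; case: z => x y /= x0.
have cy := cosK_itv y; have p1 := pihalf_ge1 R.
rewrite -[in X in X -> _](@acosK R (cos y)) ?in_itv//=.
rewrite -[in X in _ -> (X /\ _)](@acosK R (cos y)) ?in_itv//=.
have v0 : 0 <= acos (cos y) by apply: acos_ge0.
have v1 : acos (cos y) <= pi by apply: acos_lepi.
move: (acos _) v0 v1 => v v0 v1 {cy}.
have r1 := expR_ge1Dx (- x); move: (expR (- x)) r1 => r r1 rc.
split.
  have : r * (r / 2 - 1 / 4) <= r * cos v by rewrite ler_pM2l; lra.
  have := sqr_ge0 (r - 5 / 4); rewrite sqrrB !expr2; lra.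
have s0 : 0 <= sin v by apply: sin_ge0_pi; lra.
have v2 : v < pi / 2.
  rewrite ltNge; apply/negP => vp.
  have : cos v <= cos (pi / 2).
    by move: vp; rewrite le_eqVlt => /predU1P[->//|vp]; apply: ltW; rewrite ltr_cos ?in_itv/=; lra.
  by rewrite cos_pihalf; lra.
have rs0 : 0 <= r * sin v by rewrite mulr_ge0//; lra.
have rs : r * sin v <= (2 * cos v + 1 / 2) * sin v by rewrite ler_wpM2r.
have sc : 2 * cos v * sin v <= 1.
  by have := cos2Dsin2 v; have := sqr_ge0 (cos v - sin v); rewrite sqrrB; lra.
have sl : sin v <= v by have := normr_sin_le v; rewrite !ger0_norm.
have p2 : 1 < pi / 2 :> R.
  rewrite lt_neqAle p1 andbT; apply/eqP => e.
  by have := cos1_gt0 R; rewrite e cos_pihalf ltxx.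
rewrite mulrDl in rs.
by apply: cos_gt0_pihalf; apply/andP; split; lra.
Qed.

Lemma not_expanding_core z : ~ expanding z -> core (fexp z).
Proof.
move=> nf; have [x0|x0] := leP (Re z) 0.
  apply: left_core => //; apply: contrapT => /negP; rewrite -ltNge => h.
  by apply: nf; split=> [|_]; lra.
have [c0|c0] := leP (cos (Im z)) 0; last by have [] := core_step (conj x0 c0).
by case: nf; split=> // x1; lra.
Qed.

(** Stated with sin and cos so as to apply to all translates of the real axis. *)
Lemma real_core z : sin (Im z) = 0 -> cos (Im z) = 1 -> core (fexp z).
Proof.
move=> s0 c1; rewrite /core/= !fexpE s0 c1 mulr0 subr0 c1 mulr1; split => //.
by have := expR_ge1Dx (- Re z); lra.
Qed.

Lemma iter_core z n : core z -> [/\ core (iter n fexp z), Re z <= Re (iter n fexp z) &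
  cos (Im z) <= cos (Im (iter n fexp z))].
Proof.
move=> zc; elim: n => [|n [c1 c2 c3]]; first by split.
by have [d1 d2 d3] := core_step c1; split => //=; [exact: le_trans d2|exact: le_trans d3].
Qed.

Lemma iter_core_ge z m n : (m <= n)%N -> core (iter m fexp z) -> core (iter n fexp z).
Proof. by move=> /subnK <-; rewrite iterD => /iter_core -/(_ (n - m)%N)[]. Qed.

(** As long as Re <= M, each step moves to the right by at least exp(-M) c. *)
Lemma core_escape (c M : R) : 0 < c -> exists N, forall z n, (N <= n)%N ->
  core z -> c <= cos (Im z) -> M < Re (iter n fexp z).
Proof.
move=> c0; pose k := expR (- M) * c.
have k0 : 0 < k by rewrite mulr_gt0// expR_gt0.
pose N := (Num.truncn (`|M| / k)).+1; exists N => z n Nn zc cz.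
rewrite ltNge; apply/negP => zM.
have : forall j, (j <= n)%N -> j%:R * k <= Re (iter j fexp z).
  elim=> [_|j IH jn]; first by rewrite mul0r ltW//; case: zc.
  have [c1 c2 c3] := iter_core j zc.
  have xM : Re (iter j fexp z) <= M.
    apply: le_trans zM; rewrite -(subnK (ltnW jn)) iterD.
    by have [] := iter_core (n - j) c1.
  rewrite -natr1 mulrDl mul1r /= Re_fexp; apply: lerD; first exact/IH/ltnW.
  rewrite /k; apply: ler_pM; [exact: expR_ge0|exact: ltW|by rewrite ler_expR lerN2|exact: le_trans cz c3].
move/(_ n (leqnn _)) => nk.
have : `|M| / k < n%:R.
  by apply: lt_le_trans (truncnS_gt _) _; rewrite ler_nat.
rewrite ltr_pdivrMr//; have := ler_norm M; lra.
Qed.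

(** The square of |f'(z)| = |1 - exp(-z)|. *)
Definition dfexp_norm2 z : R :=
  (1 - expR (- Re z) * cos (Im z)) ^+ 2 + (expR (- Re z) * sin (Im z)) ^+ 2.

Lemma dfexp_norm2E z : dfexp_norm2 z =
  1 + expR (- Re z) * (expR (- Re z) - 2 * cos (Im z)).
Proof.
rewrite /dfexp_norm2 sqrrB !exprMn sin2cos2; move: (expR _) (cos _) => e c; ring.
Qed.

Lemma expanding_dfexp_norm2 z M : expanding z -> 0 <= M -> Re z <= M ->
  1 + Num.min (1 / 2) (expR (- M) ^+ 2) <= dfexp_norm2 z.
Proof.
move=> [f1 f2] M0 xM; rewrite dfexp_norm2E lerD2l ge_min; apply/orP.
have e0 := expR_gt0 (- Re z).
have [x0|x0] := leP (Re z) 0; [left|right].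
  have e1 : 1 <= expR (- Re z) by have := expR_ge1Dx (- Re z); lra.
  apply: le_trans (_ : 1 * (1 / 2) <= _); first lra.
  by apply: ler_pM => //; first lra; have := f2 x0; lra.
rewrite expr2; apply: ler_pM; rewrite ?expR_ge0//.
  by rewrite ler_expR lerN2.
apply: le_trans (_ : expR (- Re z) <= _); first by rewrite ler_expR lerN2.
by have := f1 x0; lra.
Qed.

End Core.

(** * Contraction of the inverse branches along paths *)

Section PathContraction.
Variable R : realType.
Local Notation C := R[i].
Implicit Types (z w s : C) (a b x y t : R) (i : bool) (c : R -> C).

Lemma normcD z w : normc (z + w) <= normc z + normc w.
Proof. exact: le_normcD. Qed.

Lemma normcN z : normc (- z) = normc z.
Proof. by rewrite !normc_sqrtE ReN ImN !sqrrN. Qed.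

Lemma normc_distC z w : normc (z - w) = normc (w - z).
Proof. by rewrite -normcN opprB. Qed.

Lemma normcM z w : normc (z * w) = normc z * normc w.
Proof. exact: Normc.normcM. Qed.

Lemma normc_ge0 z : 0 <= normc z.
Proof. by rewrite normc_sqrtE sqrtr_ge0. Qed.

Lemma normc_sqr z : normc z ^+ 2 = Re z ^+ 2 + Im z ^+ 2.
Proof. by rewrite normc_sqrtE sqr_sqrtr// addr_ge0 ?sqr_ge0. Qed.

Lemma cexpD z w : cexp (z + w) = cexp z * cexp w.
Proof.
rewrite /cexp ReD ImD expRD cosD sinD; apply: complexP => /=; ring.
Qed.

Lemma normc_cexp z : normc (cexp z) = expR (Re z).
Proof.
rewrite normc_sqrtE /= !exprMn -mulrDr cos2Dsin2 mulr1 sqrtr_sqr.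
by rewrite ger0_norm ?expR_ge0.
Qed.

Lemma cexp_taylor z : `|Re z| <= 1 / 2 -> `|Im z| <= 1 / 2 ->
  normc (cexp z - 1 - z) <= 4 * normc z ^+ 2.
Proof.
rewrite normc_sqr => p2 q2; apply: le_trans (ler_normc _) _; rewrite !ReB !ImB.
move: p2 q2; rewrite /cexp /=; move: (Re z) (Im z) => p q p2 q2.
have e1 := expR_quad_ub p2.
have c1 := one_sub_cos_le q; have s1 := sub_sin_le q.
have pp : `|p| ^+ 2 = p ^+ 2 by rewrite -normrX ger0_norm ?sqr_ge0.
have qq : `|q| ^+ 2 = q ^+ 2 by rewrite -normrX ger0_norm ?sqr_ge0.
have e2 : `|expR p - 1| <= 2 * `|p|.
  have -> : expR p - 1 = (expR p - 1 - p) + p by ring.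
  apply: le_trans (ler_normD _ _) _.
  have : `|p| ^+ 2 <= `|p| * (1 / 2) by rewrite expr2 ler_wpM2l.
  by rewrite pp; lra.
have e3 : expR p <= 2.
  have := ler_norm (expR p - 1); lra.
have r1 : `|expR p * cos q - 1 - p| <= 2 * p ^+ 2 + 2 * q ^+ 2.
  have -> : expR p * cos q - 1 - p = (expR p - 1 - p) + - (expR p * (1 - cos q)) by ring.
  apply: le_trans (ler_normD _ _) _; apply: lerD => //.
  by rewrite normrN normrM (ger0_norm (expR_ge0 _)) ler_pM ?expR_ge0.
have r2 : `|expR p * sin q - 0 - q| <= 2 * (`|p| * `|q|) + `|q| ^+ 3.
  have -> : expR p * sin q - 0 - q = (expR p - 1) * sin q + - (q - sin q) by ring.
  apply: le_trans (ler_normD _ _) _; apply: lerD; last by rewrite normrN.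
  rewrite normrM mulrA; apply: ler_pM => //; exact: normr_sin_le.
have q3 : `|q| ^+ 3 <= q ^+ 2 * (1 / 2) by rewrite exprSr qq ler_wpM2l ?sqr_ge0.
have pq : 2 * (`|p| * `|q|) <= p ^+ 2 + q ^+ 2.
  by rewrite -pp -qq; have := sqr_ge0 (`|p| - `|q|); rewrite sqrrB; lra.
apply: le_trans (lerD r1 r2) _; have := sqr_ge0 p; have := sqr_ge0 q; lra.
Qed.

Lemma normc_dfexp z : normc (1 - cexp (- z)) ^+ 2 = dfexp_norm2 z.
Proof.
by rewrite normc_sqr ReB ImB /= ReN ImN cosN sinN sub0r sqrrN mulrN sqrrN.
Qed.

(** First order expansion of f at z, with the remainder of exp bounded by
    [cexp_taylor]. *)
Lemma fexp_local_expand z (mu : R) : 0 <= mu -> mu ^+ 2 < dfexp_norm2 z ->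
  \forall u \near z, mu * normc (u - z) <= normc (fexp u - fexp z).
Proof.
move=> mu0; rewrite -normc_dfexp; set d := normc _ => mud.
have d0 : 0 <= d by exact: normc_ge0.
have {}mud : mu < d by rewrite -ltr_sqr ?nnegrE.
pose E := expR (- Re z).
have E0 : 0 < E := expR_gt0 _.
have k0 : 0 < (d - mu) / (8 * E) by rewrite divr_gt0 ?subr_gt0// mulr_gt0.
apply/nbhs_complexP; exists (Num.min (1 / 2) ((d - mu) / (8 * E))).
  by rewrite lt_min k0 andbT; lra.
move=> u; rewrite -ReB -ImB !lt_min => /andP[x1 x2] /andP[y1 y2].
set h := u - z in x1 x2 y1 y2 *.
have fE : fexp u - fexp z = h * (1 - cexp (- z)) + cexp (- z) * (cexp (- h) - 1 - (- h)).
  have -> : u = z + h by rewrite /h addrC subrK.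
  by rewrite /fexp opprD cexpD; ring.
have hE : normc h <= (d - mu) / (4 * E).
  apply: le_trans (ler_normc _) _; apply: le_trans (lerD (ltW x2) (ltW y2)) _.
  rewrite le_eqVlt; apply/orP; left; apply/eqP; field.
  by rewrite (gt_eqF E0).
have r : normc (cexp (- z) * (cexp (- h) - 1 - (- h))) <= (d - mu) * normc h.
  rewrite normcM normc_cexp ReN -/E.
  have t : normc (cexp (- h) - 1 - (- h)) <= 4 * normc h ^+ 2.
    rewrite -(normcN h); apply: cexp_taylor; rewrite ?ReN ?ImN normrN; exact: ltW.
  apply: le_trans (ler_wpM2l (ltW E0) t) _.
  rewrite expr2 !mulrA ler_wpM2r ?normc_ge0//.
  by move: hE; rewrite ler_pdivlMr ?mulr_gt0// mulrC (mulrC E).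
have : normc (h * (1 - cexp (- z))) <= normc (fexp u - fexp z) + (d - mu) * normc h.
  apply: le_trans (lerD (lexx _) r); rewrite -(normcN (cexp _ * _)).
  by apply: le_trans (normcD _ _); rewrite fE addrK.
by rewrite normcM -/d; lra.
Qed.

Definition path_lip (al be l : R) c := forall t u,
  al <= t <= be -> al <= u <= be -> normc (c u - c t) <= l * `|u - t|.

(** A path that is Lipschitz at each point, with one constant, is Lipschitz with
    this constant: take the supremum of the times up to which the bound holds. *)
Lemma path_lip_local (al be l : R) c : 0 <= l ->
  (forall t, al <= t <= be -> \forall u \near t, al <= u <= be ->
     normc (c u - c t) <= l * `|u - t|) ->
  path_lip al be l c.
Proof.
move=> l0 hloc.
suff H t u : al <= t -> t <= u -> u <= be -> normc (c u - c t) <= l * `|u - t|.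
  move=> t u /andP[t1 t2] /andP[u1 u2]; have [tu|/ltW tu] := leP t u.
    exact: H.
  by rewrite normc_distC distrC; apply: H.
move=> at0 tu ub.
pose S := [set v | t <= v <= u /\ normc (c v - c t) <= l * (v - t)].
have St : S t by split; rewrite ?lexx// subrr !subrr mulr0 normc_sqrtE/= expr0n/= addr0 sqrtr0.
have uS : ubound S u by move=> v [/andP[]].
have supS : has_sup S by split; [exists t|exists u].
pose v := sup S.
have tv : t <= v by apply: ub_le_sup => //; exists u.
have vu : v <= u by apply: sup_le_ub => //; exists t.
have vI : al <= v <= be by lra.
have /nbhs_ballP[e /= e0 hloce] := hloc v vI.
have Sv : S v.
  split; first by rewrite tv vu.
  have [w [/andP[w1 w2] w3] wv] := sup_adherent e0 supS.
  have wv' : w <= v by apply: ub_le_sup; [exists u|split; rewrite ?w1].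
  have := hloce w; rewrite /ball/= ger0_norm ?subr_ge0// => /(_ _ _).
  rewrite normc_distC distrC ger0_norm ?subr_ge0// => h.
  have {}h : normc (c v - c w) <= l * (v - w) by apply: h; rewrite -/v in wv; lra.
  have -> : c v - c t = (c v - c w) + (c w - c t) by rewrite addrA subrK.
  by apply: le_trans (normcD _ _) _; have := lerD h w3; lra.
move: Sv; have [->|vu'] := eqVneq v u.
  by move=> [_]; rewrite ger0_norm// subr_ge0.
have {}vu' : v < u by rewrite lt_neqAle vu'.
move=> [_ vt].
pose w := Num.min u (v + e / 2).
have vw : v < w by rewrite lt_min vu'/=; lra.
have wu : w <= u by rewrite ge_min lexx.
have we : w <= v + e / 2 by rewrite ge_min lexx orbT.
suff /(ub_le_sup (ex_intro _ u uS)) : S w by rewrite leNgt vw.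
split; first by rewrite wu andbT; lra.
have := hloce w; rewrite /ball/= distrC ger0_norm ?subr_ge0 ?(ltW vw)// => h.
have {}h : normc (c w - c v) <= l * (w - v) by apply: h; lra.
have -> : c w - c t = (c w - c v) + (c v - c t) by rewrite addrA subrK.
by apply: le_trans (normcD _ _) _; have := lerD h vt; lra.
Qed.

(** The translation [s] is a multiple of 2 pi i in the applications. *)
Lemma lift_lip i s (c : R -> C) (al be l mu : R) : 0 < mu -> 0 <= l ->
  path_lip al be l c ->
  (forall t, al <= t <= be -> branch_domain i (c t + s)) ->
  (forall t, al <= t <= be -> mu ^+ 2 < dfexp_norm2 (phi i (c t + s))) ->
  path_lip al be (l / mu) (fun t => phi i (c t + s)).
Proof.
move=> mu0 l0 cl dom ex; apply: path_lip_local; first by rewrite divr_ge0// ltW.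
move=> t tI.
have := phi_continuous (dom t tI) (fexp_local_expand (ltW mu0) (ex t tI)).
rewrite /nbhs/= /within/= => /nbhs_complexP[e e0 he].
have l1 : 0 < l + 1 by rewrite ltr_wpDl.
apply/nbhs_ballP; exists (e / (l + 1)) => /=; first by rewrite divr_gt0.
move=> u; rewrite /ball/= distrC ltr_pdivlMr// => ut uI.
have cut := cl t u tI uI.
have ce : normc (c u - c t) < e.
  apply: le_lt_trans cut _; apply: le_lt_trans ut; rewrite mulrC ler_wpM2l//; lra.
have dE : c u + s - (c t + s) = c u - c t by ring.
have h1 : `|Re (c u + s) - Re (c t + s)| < e.
  by rewrite -ReB dE; exact: le_lt_trans (ler_Re_normc _) ce.
have h2 : `|Im (c u + s) - Im (c t + s)| < e.
  by rewrite -ImB dE; exact: le_lt_trans (ler_Im_normc _) ce.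
have := he _ h1 h2 (dom u uI); rewrite !fexpK ?dE; [|exact: dom..].
by move=> H; rewrite mulrAC ler_pdivlMr// mulrC; apply: le_trans cut.
Qed.

End PathContraction.

(** * Pulling back vertical segments *)

Section PullbackSegments.
Variable R : realType.
Local Notation C := R[i].
Implicit Types (z w : C) (x y t : R) (k : int).

(** The periods of the exponential; f commutes with these translations. *)
Definition twist k : C := 0 +i* (k%:~R * (2 * pi)).

Lemma trig_twist y k : cos (y + k%:~R * (2 * pi)) = cos y /\
  sin (y + k%:~R * (2 * pi)) = sin y.
Proof.
have nat_case y' (n : nat) : cos (y' + n%:R * (2 * pi)) = cos y' /\
    sin (y' + n%:R * (2 * pi)) = sin y'.
  elim: n => [|n [IHc IHs]]; first by rewrite mul0r addr0.
  have cT u : cos (u + 2 * pi) = cos u :> R by rewrite mulr_natl cosD2pi.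
  have sT u : sin (u + 2 * pi) = sin u :> R by rewrite mulr_natl sinD2pi.
  by rewrite -natr1 mulrDl mul1r addrA cT sT.
case: k => n; first exact: nat_case.
rewrite NegzE mulrNz mulNr.
have [c s] := nat_case (y - n.+1%:R * (2 * pi)) n.+1.
by move: c s; rewrite subrK => -> ->.
Qed.

Lemma fexp_twist z k : fexp (z + twist k) = fexp z + twist k.
Proof.
have [c s] := trig_twist (Im z) k.
apply: complexP.
  by rewrite [RHS]ReD !Re_fexp ReD ImD /= !addr0 c.
by rewrite [RHS]ImD !Im_fexp ReD ImD /= addr0 s addrAC.
Qed.

Lemma expanding_twist z k : expanding (z + twist k) <-> expanding z.
Proof.
by have [c s] := trig_twist (Im z) k; rewrite /expanding/= ReD ImD /= c addr0.
Qed.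

Lemma core_twist z k : core (z + twist k) <-> core z.
Proof.
by have [c s] := trig_twist (Im z) k; rewrite /core/= ReD ImD /= c addr0.
Qed.

Lemma core_not_expanding z : core z -> ~ expanding z.
Proof. by move=> [x0 c0] [/(_ x0)]; rewrite leNgt c0. Qed.

(** Backward invariance: a point outside is mapped into the core, which is
    disjoint from the expanding set. *)
Lemma expanding_fexp z : expanding (fexp z) -> expanding z.
Proof. by move=> fz; apply: contrapT => /not_expanding_core /core_not_expanding. Qed.

Lemma heightD i z w : height i (z + w) = height i z + height i w.
Proof. by rewrite /height; case: i; rewrite ImD// opprD. Qed.

Lemma strip_height i z : strip z -> height i z <= pi.
Proof. by rewrite /strip/= /height ler_norml => /andP[]; case: i; lra. Qed.

Lemma expanding_branch_domain i w k : strip w -> expanding w -> height i (twist k) <= 0 ->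
  branch_domain i (w + twist k).
Proof.
move=> wS wf hk; split.
  by rewrite heightD; have := strip_height i wS; lra.
move=> w0; move/(expanding_twist w k) : wf => [f1 _].
rewrite ltNge; apply/negP => x1; have := f1 _; rewrite w0 cos0 ler10.
by move=> /(_ (lt_le_trans ltr01 x1)).
Qed.

Lemma height_strip i z : - pi <= height i z <= pi -> strip z.
Proof. by rewrite /strip/= /height ler_norml; case: i; lra. Qed.

(** Points of a vertical line, by their height in the half-strip [i]. *)
Definition vpoint i x t : C := x +i* (if i then - t else t).

Lemma height_vpoint i x t : height i (vpoint i x t) = t.
Proof. by rewrite /height /=; case: i; rewrite ?opprK. Qed.

Lemma vpoint_height i z : vpoint i (Re z) (height i z) = z.
Proof. by rewrite /height /vpoint; case: i z => -[x y] //=; rewrite opprK. Qed.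

Lemma cos_vpoint i x t : cos (Im (vpoint i x t)) = cos t.
Proof. by rewrite -(cos_height i) height_vpoint. Qed.

(** In a half-strip cos is decreasing in the height, so each vertical slice of the
    expanding set is a segment that reaches up to the outer line.  Its lower end is
    at height pi/2 on the right, on the real axis far to the left, and on the curve
    exp(-x) = 2 cos y + 1/2 in between. *)
Lemma expanding_segment i z : Omega i z -> expanding z -> exists2 al, 0 <= al <= height i z &
  (forall t, al <= t <= pi -> expanding (vpoint i (Re z) t)) /\
  core (fexp (vpoint i (Re z) al)) /\ strip (fexp (vpoint i (Re z) al)).
Proof.
move=> /OmegaE /andP[h0 hp] [f1 f2].
have stripP t : 0 <= t <= pi -> 0 <= expR (- Re z) * sin t <= 2 ->
    strip (fexp (vpoint i (Re z) t)).
  move=> tI eI; apply: (@height_strip i); rewrite height_fexp height_vpoint /=.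
  have := pi_ge2 R; lra.
have p1 := pihalf_ge1 R.
have mono t u : 0 <= t -> t <= u -> u <= pi -> cos u <= cos t.
  move=> t0; rewrite le_eqVlt => /predU1P[->//|tu] up; apply: ltW.
  by rewrite ltr_cos ?in_itv/=; lra.
have cE := cos_height i z.
have [x0|x0] := ltP 0 (Re z).
  exists (pi / 2).
    apply/andP; split; first lra.
    rewrite leNgt; apply/negP => hlt; have := f1 x0; rewrite -cE leNgt => /negP; apply.
    by apply: cos_gt0_pihalf; lra.
  split=> [t tI|].
    split=> [_|/=]; last by rewrite leNgt x0.
    by rewrite cos_vpoint -cos_pihalf; apply: mono; lra.
  split; first by apply: boundary_core => //; rewrite cos_vpoint cos_pihalf.
  apply: stripP; first lra.
  have := expR_ge0 (- Re z); have : expR (- Re z) < 1 by rewrite expR_lt1; lra.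
  by rewrite sin_pihalf mulr1; lra.
have r1 : 1 <= expR (- Re z) by have := expR_ge1Dx (- Re z); lra.
have fv t : (2 * cos t + 1 / 2 <= expR (- Re z)) -> expanding (vpoint i (Re z) t).
  by move=> ct; split => [/=|_]; [rewrite ltNge x0|rewrite cos_vpoint].
have [r2|r2] := leP (5 / 2) (expR (- Re z)).
  exists 0; first by rewrite lexx ltW.
  split=> [t tI|]; first by apply: fv; have := cos_le1 t; lra.
  split; first by apply: real_core; rewrite /=; case: (i); rewrite ?oppr0 ?sin0 ?cos0.
  by apply: stripP; rewrite ?sin0 ?mulr0 ?lexx ?pi_ge0 ?ler0n.
pose q := (expR (- Re z) - 1 / 2) / 2.
have q1 : -1 <= q <= 1 by rewrite /q; lra.
have cq : cos (acos q) = q by rewrite acosK ?in_itv.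
have a0 := acos_ge0 q1.
exists (acos q).
  rewrite a0 /= leNgt; apply/negP => hlt.
  have : cos (acos q) < cos (height i z).
    by rewrite ltr_cos ?in_itv/= ?acos_lepi ?a0//; lra.
  by rewrite cq cE; have := f2 x0; rewrite /q; lra.
split=> [t tI|].
  apply: fv; have : cos t <= cos (acos q) by apply: mono; lra.
  by rewrite cq /q; lra.
split; first by apply: left_core => //; rewrite cos_vpoint cq /= /q; lra.
have aI : 0 <= acos q <= pi by rewrite a0 acos_lepi.
apply: stripP => //.
have s0 := sin_ge0_pi aI; have s1 := sin_le1 (acos q).
rewrite mulr_ge0 ?expR_ge0//=.
have : expR (- Re z) = 2 * q + 1 / 2 by rewrite /q; lra.
move=> ->; rewrite -{1}cq.
have := sqr_ge0 (cos (acos q) - sin (acos q)); have := cos2Dsin2 (acos q).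
rewrite sqrrB; lra.
Qed.

(** An orbit of f read modulo 2 pi i, with representatives [a n] in the half-strips.
    The last condition says that the translation by [m n] brings the half-strips
    into the domain of the branch that leads back to [a n]; it holds for all orbits
    in S, where [m] is 0. *)
Definition pseudo_orbit (a : nat -> C) (i : nat -> bool) (m : nat -> int) :=
  forall n, [/\ Omega (i n) (a n), expanding (a n), fexp (a n) = a n.+1 + twist (m n) &
    height (i n) (twist (m n)) <= 0].

(** The segment through [a N] is lifted step by step: [b j] is the lift through
    [a j].  No step increases lengths, so every lift has length at
    most pi <= 4 and stays within distance 4 of the orbit; therefore the factor
    [mu], valid on Re z <= M + 4, is gained whenever Re (a j) <= M. *)
Lemma pullback_segment (M mu : R) N : 0 <= M -> 1 <= mu ->
  mu ^+ 2 < 1 + Num.min (1 / 2) (expR (- (M + 4)) ^+ 2) ->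
  forall (a : nat -> C) (i : nat -> bool) (m : nat -> int) (al : R), pseudo_orbit a i m -> 0 <= al <= height (i N) (a N) ->
  (forall t, al <= t <= pi -> expanding (vpoint (i N) (Re (a N)) t)) ->
  exists b : nat -> R -> C,
  [/\ forall t, b N t = vpoint (i N) (Re (a N)) t,
      forall j t, (j < N)%N -> al <= t <= pi ->
        Omega (i j) (b j t) /\ fexp (b j t) = b j.+1 t + twist (m j),
      forall t, al <= t <= pi -> strip (b 0%N t) /\ expanding (b 0%N t),
      b 0%N (height (i N) (a N)) = a 0%N &
      path_lip al pi (mu^-1 ^+ (\sum_(j < N) (Re (a j) <= M)%R)) (b 0%N)].
Proof.
move=> M0 mu1 muM; have mu0 : 0 < mu by lra.
have p2 := pihalf_lt2 R.
elim: N => [|N IH] a i m al po /andP[al0 alh] fv.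
  exists (fun _ => vpoint (i 0%N) (Re (a 0%N))); split => //.
  - move=> t tI; split; last exact: fv.
    apply: (@halfstrip_strip _ (i 0%N)); rewrite /halfstrip/= height_vpoint; lra.
  - exact: vpoint_height.
  - rewrite big_ord0 expr0 => t u _ _; rewrite mul1r.
    apply: le_trans (ler_normc _) _; rewrite ReB ImB /= subrr normr0 add0r.
    by case: (i 0%N); rewrite // opprK addrC distrC.
have po' : pseudo_orbit (a \o succn) (i \o succn) (m \o succn).
  by move=> n; exact: po.
have alh' : 0 <= al <= height ((i \o succn) N) ((a \o succn) N) by rewrite al0.
have [b' [b1 b2 b3 b4 b5]] := IH _ _ _ _ po' alh' fv.
have [Oa fa ea ha] := po 0%N.
set l := mu^-1 ^+ _ in b5.
have l0 : 0 <= l by rewrite exprn_ge0// invr_ge0 ltW.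
have l1 : l <= 1 by rewrite exprn_ile1 ?invr_ge0 ?(ltW mu0)// invf_le1.
pose c t := phi (i 0%N) (b' 0%N t + twist (m 0%N)).
have dom t : al <= t <= pi -> branch_domain (i 0%N) (b' 0%N t + twist (m 0%N)).
  by move=> /b3[tS tf]; apply: expanding_branch_domain.
have cO t : al <= t <= pi -> Omega (i 0%N) (c t) by move=> /dom; exact: phi_Omega.
have cf t : al <= t <= pi -> fexp (c t) = b' 0%N t + twist (m 0%N).
  by move=> /dom; exact: fexpK.
have cS t : al <= t <= pi -> strip (c t).
  by move=> /cO /Omega_halfstrip /halfstrip_strip.
have cexpanding t : al <= t <= pi -> expanding (c t).
  by move=> tI; apply: expanding_fexp; rewrite cf//; apply/expanding_twist; case: (b3 t tI).
have h1 : al <= height (i N.+1) (a N.+1) <= pi.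
  rewrite alh /=; have [/OmegaE] := po N.+1; lra.
have ca : c (height (i N.+1) (a N.+1)) = a 0%N.
  by rewrite /c [X in b' 0%N X]/= b4 /= -ea; apply: phi_eq.
have lip1 : path_lip al pi l c.
  rewrite -[l]divr1; apply: lift_lip => // t tI; rewrite expr1n -/(c t).
  have xM : 0 <= `|Re (c t)| by [].
  apply: lt_le_trans (expanding_dfexp_norm2 (cexpanding t tI) xM (ler_norm _)).
  by rewrite ltrDl lt_min exprn_gt0 ?expR_gt0// andbT; lra.
have lip2 : path_lip al pi (mu^-1 ^+ (Re (a 0%N) <= M)%R * l) c.
  have [xM|xM] := leP (Re (a 0%N)) M; last by rewrite expr0 mul1r.
  rewrite expr1 mulrC; apply: lift_lip => // t tI; rewrite -/(c t).
  apply: lt_le_trans muM _; apply: expanding_dfexp_norm2; [exact: cexpanding|lra|].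
  have := lip1 _ _ h1 tI; rewrite ca => d.
  have : `|t - height (i N.+1) (a N.+1)| <= 4 by rewrite ler_norml; lra.
  move=> d4; have := ler_pM l0 (normr_ge0 _) l1 d4 => d5.
  have := le_trans (ler_Re_normc _) (le_trans d d5); rewrite ReB ler_norml; lra.
exists (fun n => if n is n'.+1 then b' n' else c); split => //.
- by move=> [|j] t jN tI; [split; [exact: cO|exact: cf]|exact: b2].
- by move=> t tI; split; [exact: cS|exact: cexpanding].
- by rewrite big_ord_recl exprD.
Qed.

End PullbackSegments.

(** * The basin of the core *)

Section Basin.
Variable R : realType.
Local Notation C := R[i].
Implicit Types (z w : C) (x y t : R) (n : nat).

Lemma often_count (P : nat -> bool) : (forall n, exists2 j, (n <= j)%N & P j) ->
  forall k : nat, exists N : nat, (k <= \sum_(j < N) P j)%N.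
Proof.
move=> often; elim=> [|k [N kN]]; first by exists 0%N.
have [j Nj Pj] := often N; exists j.+1.
rewrite big_ord_recr /= Pj addn1 ltnS; apply: leq_trans kN _.
by rewrite -(subnKC Nj) big_split_ord /= leq_addr.
Qed.

(** In the right half-plane cos y <= 0 on the expanding set, so real parts do not
    increase there. *)
Lemma pseudo_orbit_recurrent (a : nat -> C) i m : pseudo_orbit a i m ->
  exists2 M, 0 <= M & forall n, exists2 j, (n <= j)%N & Re (a j) <= M.
Proof.
move=> po.
have [h|h] := pselect (forall n, exists2 j, (n <= j)%N & Re (a j) <= 0).
  by exists 0.
have [n hn] : exists n, forall j, (n <= j)%N -> 0 < Re (a j).
  apply: contrapT => H; apply: h => n; apply: contrapT => Hn; apply: H; exists n.
  by move=> j nj; rewrite ltNge; apply/negP => aj; apply: Hn; exists j.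
exists (Re (a n)); first exact/ltW/hn.
move=> n'; exists (n + n')%N; first exact: leq_addl.
elim: n' => [|n' IH]; first by rewrite addn0.
apply: le_trans IH; rewrite addnS.
have [_ [fa _] ea _] := po (n + n')%N.
have c0 := fa (hn _ (leq_addr _ _)).
have := congr1 (@complex.Re R) ea; rewrite Re_fexp ReD /= addr0 => <-.
by rewrite gerDl mulr_ge0_le0 ?expR_ge0.
Qed.

(** The lifts of [pullback_segment] are as short as desired, because the factor
    [mu] is gained infinitely often. *)
Lemma pullback_approx (a : nat -> C) i m (e : R) : pseudo_orbit a i m -> 0 < e ->
  exists N (al : R) (b : nat -> R -> C),
  [/\ 0 <= al <= height (i N) (a N),
      core (fexp (vpoint (i N) (Re (a N)) al)) /\
        strip (fexp (vpoint (i N) (Re (a N)) al)),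
      forall t, b N t = vpoint (i N) (Re (a N)) t,
      forall j t, (j < N)%N -> al <= t <= pi ->
        Omega (i j) (b j t) /\ fexp (b j t) = b j.+1 t + twist R (m j) &
      forall t, al <= t <= pi -> normc (b 0%N t - a 0%N) < e].
Proof.
move=> po e0; have [M M0 rec] := pseudo_orbit_recurrent po.
pose ka := Num.min (1 / 2) (expR (- (M + 4)) ^+ 2).
have ka0 : 0 < ka by rewrite lt_min exprn_gt0 ?expR_gt0// andbT; lra.
have ka1 : ka <= 1 / 2 by rewrite ge_min lexx.
(* As ka <= 1 / 2, mu ^+ 2 = 1 + ka / 2 + ka ^+ 2 / 16 is less than 1 + ka. *)
pose mu := 1 + ka / 4.
have mu1 : 1 <= mu by rewrite /mu; lra.
have mu1' : 1 < mu by rewrite /mu; lra.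
have muM : mu ^+ 2 < 1 + ka.
  have := ler_wpM2l (ltW ka0) ka1.
  rewrite /mu sqrrD expr1n mul1r expr2; lra.
have q0 : 0 <= mu^-1 by rewrite invr_ge0; lra.
have q1 : `|mu^-1| < 1 by rewrite ger0_norm// invf_lt1//; lra.
have /cvgrPdist_lt/(_ (e / 4)) := cvg_expr q1.
rewrite divr_gt0// => /(_ isT) [k _ hk].
have [N kN] := often_count rec k.
have [Oa fa _ _] := po N.
have [al alI [alf alc]] := expanding_segment Oa fa.
have [b [b1 b2 b3 b4 b5]] := pullback_segment M0 mu1 muM po alI alf.
exists N, al, b; split => // t tI.
have hI : al <= height (i N) (a N) <= pi by move: Oa => /OmegaE; lra.
have := b5 _ _ hI tI; rewrite b4 => h.
have := hk _ kN; rewrite sub0r normrN ger0_norm ?exprn_ge0// => h2.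
apply: le_lt_trans h _.
have p2 := pihalf_lt2 R.
have d4 : `|t - height (i N) (a N)| <= 4 by rewrite ler_norml; lra.
apply: le_lt_trans (ler_wpM2l _ d4) _; first by rewrite exprn_ge0.
by rewrite -ltr_pdivlMr.
Qed.

Lemma pullback_core (a : nat -> C) i m (e : R) : pseudo_orbit a i m -> 0 < e ->
  exists w n, normc (w - a 0%N) < e /\ core (iter n fexp w).
Proof.
move=> po e0; have [N [al [b [alI [ca _] b1 b2 b3]]]] := pullback_approx po e0.
have [/OmegaE hO _ _ _] := po N.
have alI' : al <= al <= pi by rewrite lexx /=; lra.
exists (b 0%N al), N.+1; split; first exact: b3.
suff [k kE] : exists k : int, iter N fexp (b 0%N al) = b N al + twist R k.
  by rewrite iterS kE b1 fexp_twist; apply/core_twist.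
suff H n : (n <= N)%N -> exists k : int, iter n fexp (b 0%N al) = b n al + twist R k.
  exact: H.
elim: n => [_|n IH nN].
  by exists 0; apply: complexP; rewrite ?ReD ?ImD /= ?mul0r addr0.
have [k kE] := IH (ltnW nN); have [_ bE] := b2 n al nN alI'.
exists (m n + k); rewrite iterS kE fexp_twist bE -addrA; congr (_ + _).
by apply: complexP; rewrite ?ReD ?ImD /= ?addr0// -mulrDl intrD.
Qed.

Definition trapped : set C := [set z | forall n, strip (iter n fexp z)].
Definition basin : set C :=
  [set z | trapped z /\ exists n, core (iter n fexp z)].
Definition itinerary (s : nat -> bool) : set C :=
  [set z | forall n, Omega (s n) (iter n fexp z)].

Lemma iter_fexpS n z : iter n fexp (fexp z) = fexp (iter n fexp z).
Proof. by rewrite -iterSr. Qed.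

Lemma halfstrip_height i z : strip z -> 0 <= height i z -> halfstrip i z.
Proof. by move=> /(strip_height i) h1 h0; apply/andP. Qed.

Lemma strip_halfstrip z : strip z -> exists i, halfstrip i z.
Proof.
move=> zS; have [y0|/ltW y0] := leP 0 (Im z).
  by exists false; apply: halfstrip_height.
by exists true; apply: halfstrip_height => //; rewrite /height oppr_ge0.
Qed.

Lemma halfstrip_right i z : halfstrip i z -> 0 <= Re z -> halfstrip i (fexp z).
Proof.
move=> /andP[h0 hp] x0; rewrite /halfstrip /= height_fexp.
have e1 : expR (- Re z) <= 1 by rewrite expR_le1 oppr_le0.
have e0 := expR_ge0 (- Re z).
have s0 : 0 <= sin (height i z) by apply: sin_ge0_pi; rewrite h0.
have sl : sin (height i z) <= height i z.
  by have := normr_sin_le (height i z); rewrite !ger0_norm.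
have := mulr_ge0 e0 s0; have := ler_pM e0 s0 e1 sl; lra.
Qed.

Lemma strip_right z : strip z -> 0 <= Re z -> strip (fexp z).
Proof.
move=> /strip_halfstrip[i zi] x0.
by apply: (@halfstrip_strip _ i); exact: halfstrip_right.
Qed.

Lemma core_trapped z : core z -> strip z -> trapped z.
Proof.
move=> zc zS; elim=> [//|n IH]; rewrite iterS; apply: strip_right => //.
by have [[/ltW]] := iter_core n zc.
Qed.

Lemma basinP z n : (forall j, (j <= n)%N -> strip (iter j fexp z)) ->
  core (iter n fexp z) -> basin z.
Proof.
move=> zS zc; split; last by exists n.
move=> j; have [/zS//|/ltnW nj] := leqP j n.
rewrite -(subnK nj) iterD; apply: core_trapped => //; exact: zS.
Qed.

Lemma trapped_fexp z : trapped z -> trapped (fexp z).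
Proof. by move=> zt n; rewrite iter_fexpS -iterS. Qed.

Lemma basin_fexp z : basin z -> basin (fexp z).
Proof.
move=> [zt [n zc]]; split; first exact: trapped_fexp.
by exists n; rewrite iter_fexpS; have [] := core_step zc.
Qed.

Lemma fexp_basin z : strip z -> basin (fexp z) -> basin z.
Proof.
move=> zS [zt [n zc]]; split; last by exists n.+1; rewrite iterSr.
by case=> [//|n']; rewrite iterSr.
Qed.

Lemma closed_strip : closed (@strip R).
Proof.
have -> : @strip R = (@complex.Im R) @^-1` `[- pi, pi].
  by apply/seteqP; split => z; rewrite /strip/= in_itv/= ler_norml.
by apply: closed_comp; [move=> z _; exact: continuous_Im|exact: itv_closed].
Qed.

Lemma closed_trapped : closed trapped.
Proof.
have -> : trapped = \bigcap_n (iter n fexp @^-1` strip).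
  by apply/seteqP; split => z zt n; [move=> _|]; exact: zt.
apply: closed_bigI => n _; apply: closed_comp; last exact: closed_strip.
by move=> z _; exact: continuous_iter_fexp.
Qed.

Lemma line_fexp i z : height i z = pi -> height i (fexp z) = pi.
Proof. by move=> hp; rewrite height_fexp hp sinpi mulr0 subr0. Qed.

(** The lines Im = pi and Im = -pi are invariant. *)
Lemma line_not_core i z n : height i z = pi -> ~ core (iter n fexp z).
Proof.
move=> hp; have {hp} : height i (iter n fexp z) = pi.
  by elim: n => [//|n IH]; exact: line_fexp.
by rewrite /core/= -(cos_height i) => ->; rewrite cospi ltr0N1 => -[].
Qed.

Lemma open_core : open (@core R).
Proof.
have -> : @core R = (@complex.Re R) @^-1` `]0, +oo[ `&`
    (fun z => cos (Im z)) @^-1` `]0, +oo[.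
  by apply/seteqP; split => z; rewrite /core/= !in_itv/= !andbT.
apply: openI; apply: open_comp; rewrite ?itv_open// => z _.
  exact: continuous_Re.
by apply: continuous_comp; [exact: continuous_Im|exact: continuous_cos].
Qed.

(** Until it reaches the core, the orbit of a point of the basin stays in the
    interior of the strip, as it cannot come back from the boundary lines; so
    finitely many open conditions characterize nearby points of the basin. *)
Lemma open_basin : open basin.
Proof.
rewrite openE => z [zt [n zc]]; rewrite /interior.
have nS j : (j <= n)%N -> \forall w \near z, strip (iter j fexp w).
  move=> jn; have yj : `|Im (iter j fexp z)| < pi.
    rewrite lt_neqAle (zt j) andbT; apply/eqP => yp.
    have [i hp] : exists i, height i (iter j fexp z) = pi.
      have [y0|y0] := leP 0 (Im (iter j fexp z)); [exists false|exists true].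
        by rewrite /height -yp ger0_norm.
      by rewrite /height -yp ltr0_norm.
    by apply: (line_not_core (n := (n - j)%N) hp); rewrite -iterD subnK.
  have : \forall w \near z, `|Im (iter j fexp w)| < pi.
    have : {for z, continuous (fun w => `|Im (iter j fexp w)|)}.
      apply: continuous_comp; last exact: norm_continuous.
      by apply: continuous_comp; [exact: continuous_iter_fexp|exact: continuous_Im].
    by move/cvgr_lt; apply.
  by apply: filterS => w /ltW.
have {nS} : \forall w \near z, forall j, (j <= n)%N -> strip (iter j fexp w).
  elim: n nS {zc} => [|n IH] nS.
    by apply: filterS (nS 0%N (leqnn _)) => w wS j; rewrite leqn0 => /eqP ->.
  have := IH (fun j jn => nS j (leqW jn)).
  apply: filterS2 (nS n.+1 (leqnn _)) => w w1 w2 j.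
  by rewrite leq_eqVlt => /predU1P[->//|]; rewrite ltnS; exact: w2.
have : \forall w \near z, core (iter n fexp w).
  apply: continuous_iter_fexp; apply: open_nbhs_nbhs; split => //; exact: open_core.
by apply: filterS2 => w wc wS; exact: basinP wS wc.
Qed.

End Basin.

(** * The limit set is the boundary of the basin *)

Section LimitSet.
Variable R : realType.
Local Notation C := R[i].
Implicit Types (z w : C) (x y t : R) (n : nat) (s : nat -> bool).

Definition limit_set : set C := @trapped R `\` @basin R.

Lemma limit_set_expanding z n : limit_set z -> expanding (iter n fexp z).
Proof.
move=> [zt zb]; apply: contrapT => /not_expanding_core zc; apply: zb; split => //.
by exists n.+1.
Qed.

(** Real points are mapped into the core in one step. *)
Lemma limit_set_nonreal z n : limit_set z -> Im (iter n fexp z) <> 0.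
Proof.
move=> [zt zb] y0; apply: zb; split => //; exists n.+1.
by apply: real_core; rewrite y0 ?sin0 ?cos0.
Qed.

Lemma limit_set_itinerary z : limit_set z -> exists s, itinerary s z.
Proof.
move=> zL; exists (fun n => Im (iter n fexp z) < 0) => n; apply/OmegaE.
have [zt _] := zL; apply/andP; split; last exact: strip_height.
have := @limit_set_nonreal z n zL; rewrite /height.
by case: (ltgtP (Im (iter n fexp z)) 0) => // h _; rewrite oppr_gt0.
Qed.

Lemma itinerary_trapped s z : itinerary s z -> trapped z.
Proof. by move=> zs n; apply/halfstrip_strip/Omega_halfstrip/zs. Qed.

Lemma itinerary_inj s s' z : itinerary s z -> itinerary s' z -> s = s'.
Proof.
move=> zs zs'; apply/funext => n; move/OmegaE: (zs n); move/OmegaE: (zs' n).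
by rewrite /height; case: (s n); case: (s' n) => //; lra.
Qed.

Lemma twist0 : twist R 0 = 0.
Proof. by rewrite /twist mul0r. Qed.

Lemma limit_set_pseudo_orbit s z : limit_set z -> itinerary s z ->
  pseudo_orbit (fun n => iter n fexp z) s (fun _ => 0).
Proof.
move=> zL zs n; split; [exact: zs|exact: limit_set_expanding|by rewrite twist0 addr0|].
by rewrite twist0 /height; case: (s n); rewrite ?oppr0.
Qed.

Lemma nbhs_normc z A : nbhs z A ->
  exists2 e : R, 0 < e & forall w, normc (w - z) < e -> A w.
Proof.
move=> /nbhs_complexP[e e0 eA]; exists e => // w wz; apply: eA.
  by rewrite -ReB; apply: le_lt_trans (ler_Re_normc _) wz.
by rewrite -ImB; apply: le_lt_trans (ler_Im_normc _) wz.
Qed.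

(** The lower end of the pulled back segment belongs to the basin. *)
Lemma limit_set_closure_basin : limit_set `<=` closure (@basin R).
Proof.
move=> z zL A /nbhs_normc[e e0 eA]; have [s zs] := limit_set_itinerary zL.
have [N [al [b [alI [ca sa] b1 b2 b3]]]] :=
  pullback_approx (limit_set_pseudo_orbit zL zs) e0.
have /OmegaE hO := zs N.
have alI' : al <= al <= pi by rewrite lexx /=; lra.
exists (b 0%N al); split; last exact/eA/b3.
have it n : (n <= N)%N -> iter n fexp (b 0%N al) = b n al.
  elim: n => [//|n IH nN]; rewrite iterS (IH (ltnW nN)).
  by have [_ ->] := b2 n al nN alI'; rewrite twist0 addr0.
apply: (@basinP _ _ N.+1); last by rewrite iterS it// b1.
move=> j; rewrite leq_eqVlt => /predU1P[->|]; first by rewrite iterS it// b1.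
rewrite ltnS leq_eqVlt => /predU1P[->|jN].
  by rewrite it// b1; apply: (@height_strip _ (s N)); rewrite height_vpoint; have := pi_ge0 R; lra.
have [Oj _] := b2 j al jN alI'.
by rewrite it ?(ltnW jN)//; exact: halfstrip_strip (Omega_halfstrip Oj).
Qed.

Lemma boundary_basin : boundary (@basin R) = limit_set.
Proof.
have /interior_id bo := @open_basin R.
rewrite /boundary bo; apply/seteqP; split => z.
  move=> [zc zb]; split => //; apply: closed_trapped.
  by apply: closure_subset zc => w [].
by move=> zL; split; [exact: limit_set_closure_basin|case: zL].
Qed.

Lemma line_Re_iter i z n : height i z = pi ->
  Re (iter n fexp z) = iter n (@Fexp R) (Re z) /\ height i (iter n fexp z) = pi.
Proof.
move=> hp; elim: n => [//|n [IHr IHh]]; split; last exact: line_fexp.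
by rewrite iterS Re_fexp -(cos_height i) IHh cospi mulrN1 IHr.
Qed.

(** The upper end of the pulled back segment is eventually mapped to one of the
    invariant lines Im = pi and Im = -pi, so its itinerary is eventually constant. *)
Lemma limit_set_line_approx z (e : R) : limit_set z -> 0 < e -> exists w s' N,
  [/\ normc (w - z) < e, itinerary s' w & exists i, height i (iter N fexp w) = pi].
Proof.
move=> zL e0; have [s zs] := limit_set_itinerary zL.
have [N [al [b [alI _ b1 b2 b3]]]] :=
  pullback_approx (limit_set_pseudo_orbit zL zs) e0.
have /OmegaE hO := zs N.
have alI' : al <= (pi : R) <= pi by apply/andP; split => //; lra.
have it n : (n <= N)%N -> iter n fexp (b 0%N pi) = b n pi.
  elim: n => [//|n IH nN]; rewrite iterS (IH (ltnW nN)).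
  by have [_ ->] := b2 n pi nN alI'; rewrite twist0 addr0.
have hN : height (s N) (iter N fexp (b 0%N pi)) = pi.
  by rewrite it// b1 height_vpoint.
exists (b 0%N pi), (fun n => s (minn n N)), N; split; [exact: b3| |by exists (s N)].
move=> n; have [nN|nN] := ltnP n N.
  by rewrite it ?(ltnW nN)//; case: (b2 n pi nN alI').
apply/OmegaE; rewrite -(subnK nN) iterD.
by have [_ ->] := line_Re_iter (n - N) hN; rewrite lexx pi_gt0.
Qed.

Lemma limit_set_right_nonincreasing z n : limit_set z -> 0 < Re (iter n fexp z) ->
  Re (iter n.+1 fexp z) <= Re (iter n fexp z).
Proof.
move=> zL x0; have [/(_ x0) c0 _] := @limit_set_expanding z n zL.
by rewrite iterS Re_fexp gerDl mulr_ge0_le0 ?expR_ge0.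
Qed.

Lemma Re_fexp_ge z : 0 <= Re z -> Re z - 1 <= Re (fexp z).
Proof.
move=> x0; rewrite Re_fexp lerD2l.
have e1 : expR (- Re z) <= 1 by rewrite expR_le1 oppr_le0.
have e0 := expR_ge0 (- Re z).
have := ler_pM e0 (normr_ge0 (cos (Im z))) e1 (cos_max (Im z)).
by rewrite -[X in X * `|_|](ger0_norm e0) -normrM mulr1 ler_norml => /andP[].
Qed.

(** Real parts do not increase in the right half-plane and steps there have length
    at most 1; an orbit that is far to the right at a late time stays there, and is
    bounded. *)
Lemma limit_set_escape_left z : limit_set z ->
  (forall M : R, \forall n \near \oo, M < normc (iter n fexp z)) ->
  forall M : R, \forall n \near \oo, Re (iter n fexp z) < M.
Proof.
move=> zL esc M; have p2 := pihalf_lt2 R.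
pose L := `|M| + 2.
have L0 : 2 <= L by rewrite /L lerDr.
have big : \forall n \near \oo, L < `|Re (iter n fexp z)|.
  apply: filterS (esc (L + 4)) => n h.
  have := le_trans (ltW h) (ler_normc _).
  have : `|Im (iter n fexp z)| <= pi by case: zL => /(_ n).
  lra.
have [n0 _ bign0] := big.
have [n1 _ left] : \forall n \near \oo, Re (iter n fexp z) < 0.
  apply: contrapT => nl.
  have [n [n0n xn]] : exists n, (n0 <= n)%N /\ 0 <= Re (iter n fexp z).
    apply: contrapT => H; apply: nl; exists n0 => // n /= n0n.
    by rewrite ltNge; apply/negP => xn; apply: H; exists n.
  have stay k : L < Re (iter (n + k) fexp z) <= Re (iter n fexp z).
    elim: k => [|k IH].
      by rewrite addn0 lexx andbT; have := bign0 _ n0n; rewrite ger0_norm.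
    have x0 : 0 < Re (iter (n + k) fexp z) by lra.
    have := limit_set_right_nonincreasing zL x0; have := Re_fexp_ge (ltW x0).
    rewrite -iterS -addnS => h1 h2.
    have := bign0 (n + k.+1)%N (leq_trans n0n (leq_addr _ _)).
    rewrite /= ger0_norm; lra.
  have [n2 _ /(_ (n + n2)%N (leq_addl _ _))] := esc (Re (iter n fexp z) + 4).
  rewrite ltNge => /negP; apply; apply: le_trans (ler_normc _) _.
  have : `|Im (iter (n + n2) fexp z)| <= pi by case: zL => /(_ (n + n2)%N).
  have /andP[s1 s2] := stay n2.
  have s0 : 0 <= Re (iter (n + n2) fexp z) by lra.
  rewrite (ger0_norm s0); lra.
exists (maxn n0 n1) => // n /=; rewrite geq_max => /andP[h0 h1].
have := bign0 n h0; have := left n h1; rewrite /= => x0; rewrite ltr0_norm// /L.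
have := ler_norm (- M); rewrite normrN; lra.
Qed.

End LimitSet.

(** * Uniqueness of the point on a ray at a given time *)

Section PointsOnRays.
Variable R : realType.
Local Notation C := R[i].
Local Notation F := (@Fexp R).
Implicit Types (z w : C) (x y t u : R) (n k : nat) (s : nat -> bool).

Lemma Fexp_dec t : F t <= t.
Proof. by rewrite /Fexp gerBl expR_ge0. Qed.

Lemma iter_Fexp_lin t k : iter k F t <= t - k%:R * expR (- t).
Proof.
elim: k => [|k IH]; first by rewrite mul0r subr0.
rewrite iterS -natr1 mulrDl mul1r opprD addrA /Fexp; apply: lerB => //.
rewrite ler_expR lerN2; apply: le_trans IH _.
by rewrite gerBl mulr_ge0 ?expR_ge0.
Qed.

Lemma iter_Fexp_mono t m n : (m <= n)%N -> iter n F t <= iter m F t.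
Proof.
move=> /subnK <-; rewrite iterD; elim: (n - m)%N => [//|k IH].
by rewrite iterS; exact: le_trans (Fexp_dec _) IH.
Qed.

Lemma iter_Fexp_cvg t M : exists n, forall k, (n <= k)%N -> iter k F t < M.
Proof.
exists (Num.truncn (`|t - M| / expR (- t))).+1 => k nk.
apply: le_lt_trans (iter_Fexp_lin _ _) _.
have : `|t - M| / expR (- t) < k%:R.
  by apply: lt_le_trans (truncnS_gt _) _; rewrite ler_nat.
rewrite ltr_pdivrMr ?expR_gt0//; have := ler_norm (t - M); lra.
Qed.

(** The interval for f(z) forces the one for z.  If Re z > u, then Re f(z) > F(u).
    If Re z < u - pi, the step |f(z) - z| = exp(- Re z) is too long for a step
    between two points of the strip with these real parts. *)
Lemma fexp_window_back u z : u <= -2 -> strip z -> strip (fexp z) ->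
  F u - pi <= Re (fexp z) <= F u -> u - pi <= Re z <= u.
Proof.
move=> u2 zS wS /andP[h1 h2].
have p1 := pi_ge2 R; have p2 := pihalf_lt2 R.
have xu : Re z <= u.
  rewrite leNgt; apply/negP => ux.
  have e1 : expR (- Re z) <= expR (- u) by rewrite ler_expR; lra.
  have e0 := expR_ge0 (- Re z).
  have : - expR (- Re z) <= expR (- Re z) * cos (Im z).
    by rewrite -[leLHS]mulrN1 ler_wpM2l// cos_geN1.
  by rewrite Re_fexp /Fexp in h2; lra.
rewrite xu andbT leNgt; apply/negP => xl.
pose d := u - Re z.
have dp : pi < d by rewrite /d; lra.
have eE : expR (- Re z) = expR (- u) * expR d by rewrite -expRD /d; congr expR; ring.
have u0 : 0 <= - u by lra.
have d0 : 0 <= d by lra.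
have qu := expR_ge_quad u0; have qd := expR_ge_quad d0.
have b1 : 5 <= expR (- u).
  have : 2 * 2 <= (- u) ^+ 2 by rewrite expr2 ler_pM//; lra.
  lra.
have b2 : 2 * d <= d ^+ 2 by rewrite expr2 ler_wpM2r//; lra.
have := expR_le_dist z; rewrite eE.
have : `|Im (fexp z) - Im z| <= 8.
  by move: zS wS; rewrite /strip/= !ler_norml; lra.
have : `|Re (fexp z) - Re z| <= expR (- u) + d.
  by rewrite ler_norml; rewrite /Fexp in h1 h2; rewrite /d; lra.
have : 5 * (expR d - 1) <= expR (- u) * (expR d - 1) by rewrite ler_wpM2r//; lra.
lra.
Qed.

(** With d = z - w, |exp(-z) - exp(-w)| >= exp(2) |2 sinh(d/2)| is at least 5/2 |d|
    because |Im d| <= pi; the identity part of f costs at most |d|. *)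
Lemma fexp_expand_left i z w : halfstrip i z -> halfstrip i w -> Re z <= -2 -> Re w <= -2 ->
  3 / 2 * normc (z - w) <= normc (fexp z - fexp w).
Proof.
move=> zi wi z2 w2.
suff H : 5 / 2 * normc (z - w) <= normc (cexp (- z) - cexp (- w)).
  have -> : fexp z - fexp w = (z - w) + (cexp (- z) - cexp (- w)).
    by rewrite /fexp; ring.
  have := normcD ((z - w) + (cexp (- z) - cexp (- w))) (- (z - w)).
  by rewrite addrAC subrr add0r normcN; lra.
rewrite -ler_sqr ?nnegrE ?mulr_ge0 ?normc_ge0// exprMn !normc_sqr !ReB !ImB /=.
rewrite !ReN !ImN !cosN !sinN.
have th : `|Im z - Im w| <= pi.
  move: zi wi; rewrite /halfstrip/= /height ler_norml; case: (i); lra.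
have := one_sub_cos_ge th; rewrite cosB.
move: (Im z) (Im w) (cos2Dsin2 (Im z)) (cos2Dsin2 (Im w)) => y v.
move: (cos y) (sin y) (cos v) (sin v) => cy sy cv sv e1 e2 e3.
have a0 : 0 <= - Re z by lra.
have b0 : 0 <= - Re w by lra.
have qa := expR_ge_quad a0; have qb := expR_ge_quad b0.
have a1 : 5 <= expR (- Re z).
  have : 2 * 2 <= (- Re z) ^+ 2 by rewrite expr2 ler_pM//; lra.
  lra.
have b1 : 5 <= expR (- Re w).
  have : 2 * 2 <= (- Re w) ^+ 2 by rewrite expr2 ler_pM//; lra.
  lra.
have d1 : 5 * `|Re z - Re w| <= `|expR (- Re z) - expR (- Re w)|.
  wlog xw : z w {zi wi th e3} z2 w2 a0 b0 qa qb a1 b1 / Re z <= Re w.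
    move=> H; have [/H->//|/ltW/H h] := leP (Re z) (Re w).
    by rewrite distrC [leRHS]distrC h.
  have ee : expR (- Re w) <= expR (- Re z) by rewrite ler_expR; lra.
  rewrite distrC !ger0_norm ?subr_ge0//.
  have -> : expR (- Re z) = expR (- Re w) * expR (Re w - Re z).
    by rewrite -expRD; congr expR; ring.
  have := expR_ge1Dx (Re w - Re z) => q.
  have : 5 * (expR (Re w - Re z) - 1) <= expR (- Re w) * (expR (Re w - Re z) - 1).
    by rewrite ler_wpM2r//; lra.
  lra.
have d2 : 25 * (Re z - Re w) ^+ 2 <= (expR (- Re z) - expR (- Re w)) ^+ 2.
  have : (5 * `|Re z - Re w|) ^+ 2 <= `|expR (- Re z) - expR (- Re w)| ^+ 2.
    by rewrite ler_sqr// nnegrE mulr_ge0.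
  rewrite exprMn !real_normK ?num_real//; lra.
have ab : 25 <= expR (- Re z) * expR (- Re w).
  have five : 0 <= 5 :> R by [].
  have := ler_pM five five a1 b1; lra.
have k0 : 0 <= 1 - (cy * cv + sy * sv).
  by apply: le_trans e3; rewrite divr_ge0// sqr_ge0.
have d3 := ler_wpM2r k0 ab.
move: (expR (- Re z)) (expR (- Re w)) d2 d3 => A B d2 d3.
have -> : (A * cy - B * cv) ^+ 2 + (A * - sy - B * - sv) ^+ 2 =
  A ^+ 2 * (cy ^+ 2 + sy ^+ 2) + B ^+ 2 * (cv ^+ 2 + sv ^+ 2) -
  2 * (A * B) * (cy * cv + sy * sv) by ring.
rewrite e1 e2 !mulr1.
have := sqr_ge0 (Re z - Re w).
have -> : A ^+ 2 + B ^+ 2 - 2 * (A * B) * (cy * cv + sy * sv) =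
  (A - B) ^+ 2 + 2 * (A * B * (1 - (cy * cv + sy * sv))) by ring.
have -> : (5 / 2 : R) ^+ 2 = 25 / 4 by field.
lra.
Qed.

Definition window t n z := iter n F t - pi <= Re (iter n fexp z) <= iter n F t.

(** The closed description of the ray point at time [t]; see [on_rayE]. *)
Definition on_ray s t z := itinerary s z /\
  forall k, iter k F t <= -2 -> window t k z.

Lemma itinerary_strip s z n : itinerary s z -> strip (iter n fexp z).
Proof. by move=> /itinerary_trapped. Qed.

Lemma window_down s t z n : itinerary s z -> iter n F t <= -2 ->
  window t n.+1 z -> window t n z.
Proof.
move=> zs n2 w; apply: fexp_window_back => //; first exact: itinerary_strip zs.
by rewrite -iterS; exact: itinerary_strip zs.
Qed.

Lemma on_ray_eventually s t z n : itinerary s z ->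
  (forall k, (n <= k)%N -> window t k z) -> on_ray s t z.
Proof.
move=> zs wn; split => // k k2; have [/wn//|/ltnW kn] := leqP n k.
have : window t n z by exact: wn.
rewrite -(subnK kn); elim: (n - k)%N => [//|j IH]; rewrite addSn => /(window_down zs) h.
by apply/IH/h; apply: le_trans (iter_Fexp_mono _ (leq_addl _ _)) k2.
Qed.

(** Two such points have iterates at bounded distance, while the distance grows by
    a factor 3/2 at each step in the left half-plane. *)
Lemma on_ray_unique s t z w : on_ray s t z -> on_ray s t w -> z = w.
Proof.
move=> [zs zw] [ws ww].
have [n nt] := iter_Fexp_cvg t (-2).
have p2 := pihalf_lt2 R; have p1 := pi_ge2 R.
(* Beyond the time n all iterates have real part at most -2. *)
have grow j : (3 / 2) ^+ j * normc (iter n fexp z - iter n fexp w) <=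
    normc (iter (n + j) fexp z - iter (n + j) fexp w).
  elim: j => [|j IH]; first by rewrite addn0 expr0 mul1r.
  have k2 := ltW (nt (n + j)%N (leq_addr _ _)).
  rewrite addnS exprS !iterS -mulrA.
  apply: le_trans (_ : 3 / 2 * normc (iter (n + j) fexp z - iter (n + j) fexp w) <= _).
    by rewrite ler_wpM2l// divr_ge0.
  apply: (@fexp_expand_left (s (n + j)%N)); try exact: Omega_halfstrip.
    by have /andP[_] := zw _ k2; lra.
  by have /andP[_] := ww _ k2; lra.
have bound j : normc (iter (n + j) fexp z - iter (n + j) fexp w) <= 12.
  have k2 := ltW (nt (n + j)%N (leq_addr _ _)).
  apply: le_trans (ler_normc _) _; rewrite ReB ImB.
  have : `|Re (iter (n + j) fexp z) - Re (iter (n + j) fexp w)| <= 4.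
    by have /andP[? ?] := zw _ k2; have /andP[? ?] := ww _ k2; rewrite ler_norml; lra.
  have : `|Im (iter (n + j) fexp z) - Im (iter (n + j) fexp w)| <= 8.
    have := @itinerary_strip s z (n + j) zs; have := @itinerary_strip s w (n + j) ws.
    by rewrite /strip/= !ler_norml; lra.
  lra.
have nE : iter n fexp z = iter n fexp w.
  apply/eqP; rewrite -subr_eq0; apply/eqP/Normc.eq0_normc; apply: contrapT => /eqP d0.
  have {}d0 : 0 < normc (iter n fexp z - iter n fexp w) by rewrite lt_neqAle eq_sym d0 normc_ge0.
  set d := normc _ in d0 grow.
  have q : `|(3 / 2)^-1 : R| < 1 by rewrite ger0_norm ?invr_ge0 ?invf_lt1//; lra.
  have /cvgrPdist_lt/(_ (d / 12)) := cvg_expr q.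
  rewrite divr_gt0// => /(_ isT) [k _ /(_ k (leqnn _))].
  rewrite sub0r normrN /= ger0_norm ?exprn_ge0 ?invr_ge0 ?divr_ge0// exprVn.
  rewrite invf_plt ?posrE ?exprn_gt0 ?divr_gt0// => h.
  have := le_trans (grow k) (bound k); rewrite leNgt => /negP; apply.
  by rewrite -ltr_pdivrMr// -[X in X < _]invf_div.
clear grow bound; elim: n nE {nt} => [//|n IH]; rewrite !iterS => e.
by apply: IH; apply: (@Omega_inj _ (s n)).
Qed.

End PointsOnRays.

(** * Dynamic rays and the points they cover *)

Section DynamicRays.
Variable R : realType.
Local Notation C := R[i].
Local Notation F := (@Fexp R).
Implicit Types (z w : C) (x y t u : R) (n k : nat) (s : nat -> bool).

Lemma Omega_dom i j z : Omega i z -> branch_domain j z.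
Proof.
move=> zi; split; last by move/(Omega_nonreal zi).
exact/strip_height/(halfstrip_strip (Omega_halfstrip zi)).
Qed.

(** Compositions of branches are defined on the whole orbit: each value lies in a
    half-strip, off the real axis, hence in the domain of the next branch. *)
Lemma phisP n s w : branch_domain (s n) w ->
  (forall j, (j <= n)%N -> Omega (s j) (iter j fexp (phis n.+1 s w))) /\
  iter n.+1 fexp (phis n.+1 s w) = w.
Proof.
elim: n s => [|n IH] s dw.
  by split => [[|//] _|/=]; [exact: phi_Omega|exact: fexpK].
have [h1 h2] := IH (shift s) dw.
have d : branch_domain (s 0%N) (phis n.+1 (shift s) w) by apply: Omega_dom (h1 0%N _).
rewrite -[phis n.+2 s w]/(phi (s 0%N) (phis n.+1 (shift s) w)).
split; last by rewrite iterSr fexpK.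
by case=> [_|j jn]; [exact: phi_Omega|rewrite iterSr fexpK//; exact: h1].
Qed.

Lemma phis_eq n s z : (forall j, (j < n)%N -> Omega (s j) (iter j fexp z)) ->
  phis n s (iter n fexp z) = z.
Proof.
elim: n s z => [//|n IH] s z zs; rewrite iterSr /=.
rewrite IH; last by move=> j jn; rewrite -iterSr; exact: zs.
by apply: phi_eq => //; exact: (zs 0%N).
Qed.

(** An iterate on the real axis would make the orbit enter the core, contradicting
    the bounds on the real parts; so closed half-strips are enough. *)
Lemma window_itinerary s t z n : iter n F t <= -2 ->
  (forall k, halfstrip (s k) (iter k fexp z)) ->
  (forall k, (n <= k)%N -> window t k z) -> on_ray s t z.
Proof.
move=> nt hz wz; apply: on_ray_eventually (wz) => k.
apply: halfstrip_Omega => // y0.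
have c1 : core (iter k.+1 fexp z) by apply: real_core; rewrite y0 ?sin0 ?cos0.
have [x0 _] := iter_core_ge (leq_maxr n k.+1) c1.
have /andP[_] := wz _ (leq_maxl n k.+1).
have := iter_Fexp_mono t (leq_maxl n k.+1); lra.
Qed.

Lemma closed_Re_itv (a b : R) n : closed [set z : C | a <= Re (iter n fexp z) <= b].
Proof.
have -> : [set z : C | a <= Re (iter n fexp z) <= b] =
    (fun z : C => Re (iter n fexp z)) @^-1` `[a, b].
  by apply/seteqP; split => z; rewrite /= in_itv.
apply: closed_comp; last exact: itv_closed.
by move=> z _; apply: continuous_comp; [exact: continuous_iter_fexp|exact: continuous_Re].
Qed.

Lemma closed_iter_halfstrip i n : closed [set z : C | halfstrip i (iter n fexp z)].
Proof.
apply: (closed_comp (f := iter n fexp)); last exact: closed_halfstrip.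
by move=> z _; exact: continuous_iter_fexp.
Qed.

(** Take any point in the N-th square and pull it back to time 0; a cluster point as
    N tends to oo satisfies all conditions, since they are closed. *)
Lemma on_ray_exists_left s t : t <= -2 -> exists z, on_ray s t z.
Proof.
move=> t2.
have Ft k : iter k F t <= -2 by apply: le_trans (iter_Fexp_mono t (leq0n k)) _.
have p0 := pi_gt0 R.
pose q N := vpoint (s N) (iter N F t - pi / 2) (pi / 2).
have qO N : Omega (s N) (q N) by apply/OmegaE; rewrite height_vpoint; lra.
pose z N := phis N s (q N).
have zq N : iter N fexp (z N) = q N.
  case: N => [//|N]; have [_ ->//] := @phisP N s (q N.+1) (Omega_dom _ (qO N.+1)).
have zO N j : (j <= N)%N -> Omega (s j) (iter j fexp (z N)).
  case: N => [|N]; first by rewrite leqn0 => /eqP ->; exact: qO.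
  rewrite leq_eqVlt => /predU1P[->|]; first by rewrite zq; exact: qO.
  rewrite ltnS; case: (@phisP N s (q N.+1) (Omega_dom _ (qO N.+1))) => h _; exact: h.
have zS N j : (j <= N)%N -> strip (iter j fexp (z N)).
  by move=> jN; exact: halfstrip_strip (Omega_halfstrip (zO N j jN)).
have zw N j : (j <= N)%N -> window t j (z N).
  move=> jN; have wN : window t N (z N) by rewrite /window zq /= ; lra.
  have : (N - j <= N)%N by rewrite leq_subr.
  rewrite -{2}(subKn jN); elim: (N - j)%N => [|d IH] dN; first by rewrite subn0.
  have e : (N - d)%N = (N - d.+1).+1 by rewrite subnSK.
  apply: fexp_window_back => //; first exact: zS (leq_subr _ _).
    by rewrite -iterS -e; exact: zS (leq_subr _ _).
  by have := IH (ltnW dN); rewrite e.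
have [w [_ cw]] : box (t - pi) t (- pi) pi `&` cluster (z n @[n --> \oo]) !=set0.
  apply: compact_box; exists 0%N => // N _; split; first exact: (zw N 0%N).
  by have := zS N 0%N (leq0n _); rewrite /strip/= ler_norml.
have clo A j : closed A -> (forall N, (j <= N)%N -> A (z N)) -> A w.
  move=> cA zA; apply: cA => B nB.
  by apply: cw nB; exists j.
exists w; apply: (@window_itinerary s t w 0%N) => // k.
  by apply: (clo _ k (@closed_iter_halfstrip (s k) k)) => N kN; exact/Omega_halfstrip/zO.
by move=> _; apply: (clo _ k (@closed_Re_itv _ _ k)) => N kN; exact: zw.
Qed.

(** A point of the closed square is approached along the segment to its centre. *)
Lemma closure_square s t n : closure (square t s n) =
  [set z | iter n F t - pi <= Re z <= iter n F t /\ halfstrip (s n) z].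
Proof.
have p0 := pi_gt0 R; have p2 := pihalf_lt2 R.
apply/seteqP; split => [z zc|z [/andP[x1 x2] /andP[h1 h2]]].
  have c : closed ([set z : C | iter n F t - pi <= Re z <= iter n F t] `&` halfstrip (s n)).
    apply: closedI; first exact: (@closed_Re_itv _ _ 0%N).
    exact: closed_halfstrip.
  suff : ([set z : C | iter n F t - pi <= Re z <= iter n F t] `&` halfstrip (s n)) z by [].
  apply: c; apply: closure_subset zc => w [/andP[w1 w2] w3]; split.
    by apply/andP; split; exact: ltW.
  by rewrite /halfstrip/= /height; case: (s n) w3 => /andP[]; lra.
move=> A /nbhs_complexP[e e0 eA].
(* The centre is at distance at most pi / 2 < 2 in each coordinate. *)
pose d := Num.min (1 / 2) (e / 8).
have d0 : 0 < d by rewrite lt_min; apply/andP; split; lra.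
have d1 : d <= 1 / 2 by rewrite ge_min lexx.
have d2 : d <= e / 8 by rewrite ge_min lexx orbT.
pose x := Re z; pose h := height (s n) z; pose T := iter n F t.
pose cx := T - pi / 2; pose ch : R := pi / 2.
have d2' : 2 * d < e by lra.
have X1 : `|(x + d * (cx - x)) - x| < e.
  rewrite addrAC subrr add0r normrM gtr0_norm//.
  apply: le_lt_trans d2'; rewrite mulrC ler_wpM2r ?(ltW d0)//.
  by rewrite ler_norml /cx /x /T; lra.
have H1 : `|(h + d * (ch - h)) - h| < e.
  rewrite addrAC subrr add0r normrM gtr0_norm//.
  apply: le_lt_trans d2'; rewrite mulrC ler_wpM2r ?(ltW d0)//.
  by rewrite ler_norml /ch /h; lra.
exists (vpoint (s n) (x + d * (cx - x)) (h + d * (ch - h))); split; last first.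
  apply: eA => //=; move: H1; rewrite /h /height; case: (s n) => //.
  by rewrite opprK -normrN; congr (`|_| < _); ring.
have X2 : T - pi < x + d * (cx - x) < T.
  have -> : x + d * (cx - x) = (1 - d) * x + d * cx by ring.
  have a1 : (1 - d) * (T - pi) <= (1 - d) * x by rewrite ler_wpM2l//; lra.
  have a2 : (1 - d) * x <= (1 - d) * T by rewrite ler_wpM2l//; lra.
  have a3 : 0 < d * pi by rewrite mulr_gt0.
  by rewrite /cx; apply/andP; split; lra.
have H2 : 0 < h + d * (ch - h) < pi.
  have -> : h + d * (ch - h) = (1 - d) * h + d * ch by ring.
  have a1 : 0 <= (1 - d) * h by rewrite mulr_ge0//; lra.
  have a2 : (1 - d) * h <= (1 - d) * pi by rewrite ler_wpM2l//; lra.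
  have a3 : 0 < d * pi by rewrite mulr_gt0.
  by rewrite /ch; apply/andP; split; lra.
by split => //=; case: (s n); lra.
Qed.

Lemma escaping_tail_on_ray s t : t <= -2 -> on_ray s t (escaping_tail s t).
Proof.
move=> t2; have [z zt] := on_ray_exists_left s t2.
have Ft k : iter k F t <= -2 by apply: le_trans (iter_Fexp_mono t (leq0n k)) _.
have H : (\bigcap_n (phis n.+1 s @` closure (square t s n.+1))) (escaping_tail s t).
  apply: xgetPex; exists z => n _; exists (iter n.+1 fexp z).
    rewrite closure_square; have [zs zw] := zt; split; first exact: zw.
    exact/Omega_halfstrip/zs.
  by apply: phis_eq => j _; case: zt.
move: (escaping_tail s t) H => w H.
have {}H n : (forall j, (j <= n)%N -> Omega (s j) (iter j fexp w)) /\ window t n.+1 w.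
  have [v] := H n I; rewrite closure_square => -[vw vh] <-.
  have dv : branch_domain (s n) v.
    split; first exact/strip_height/(halfstrip_strip vh).
    by move=> _; move: vw => /andP[_]; have := Ft n.+1; lra.
  by have [h1 h2] := phisP dv; rewrite /window h2.
apply: (@on_ray_eventually _ s t w 1%N) => [n|[//|k] _]; last by case: (H k).
by case: (H n) => h _; exact: h.
Qed.

Lemma on_ray_phis n s t z : on_ray (iter n shift s) (iter n F t) z ->
  on_ray s t (phis n s z).
Proof.
elim: n s t z => [//|n IH] s t z; rewrite [iter n.+1 shift s]iterSr iterSr => /IH.
rewrite -[phis n.+1 s z]/(phi (s 0%N) (phis n (shift s) z)).
move: (phis n _ z) => {}z [zs zw].
have dz : branch_domain (s 0%N) z by exact: Omega_dom (zs 0%N).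
have [m mt] := iter_Fexp_cvg t (-2).
apply: (@on_ray_eventually _ s t _ m.+1) => [[|k]|[//|k] mk].
- exact: phi_Omega.
- by rewrite iterSr fexpK//; exact: zs.
- have := zw k; rewrite /window iterSr [iter k.+1 fexp _]iterSr fexpK//; apply.
  by rewrite -iterSr; exact/ltW/mt/ltnW.
Qed.

Lemma dynamic_ray_on_ray s t : on_ray s t (dynamic_ray s t).
Proof.
rewrite /dynamic_ray; set n := xget _ _.
have nt : iter n F t < -2.
  apply: (@xgetPex _ 0%N [set n | iter n F t < -2]).
  by have [m mt] := iter_Fexp_cvg t (-2); exists m; exact: mt.
by apply: on_ray_phis; apply: escaping_tail_on_ray; exact: ltW.
Qed.

Lemma on_rayE s t z : on_ray s t z <-> dynamic_ray s t = z.
Proof.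
split=> [|<-]; last exact: dynamic_ray_on_ray.
exact: on_ray_unique (dynamic_ray_on_ray s t).
Qed.

Lemma on_ray_left s t z M : on_ray s t z -> \forall n \near \oo, Re (iter n fexp z) < M.
Proof.
move=> [zs zw]; have [n nt] := iter_Fexp_cvg t (Num.min (-2) M).
exists n => // k /= nk; have := nt k nk; rewrite lt_min => /andP[k2 kM].
by have /andP[_] := zw k (ltW k2); move=> h; exact: le_lt_trans h kM.
Qed.

Lemma on_ray_limit_set s t z : on_ray s t z -> limit_set z.
Proof.
move=> zt; split; first by case: zt => /itinerary_trapped.
move=> [_ [n zc]]; have [m _ /(_ (maxn n m) (leq_maxr _ _)) /=] := on_ray_left 0 zt.
have [x0 _] := iter_core_ge (leq_maxl n m) zc; lra.
Qed.

(** The condition on [t] given by the k-th iterate says that F^k(t) lies in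
    [x k, x k + pi]; by [fexp_window_back] the corresponding intervals of times are
    nested for large k, and the supremum of their left ends is a common point. *)
Lemma itinerary_left_on_ray s z : itinerary s z ->
  (forall M : R, \forall n \near \oo, Re (iter n fexp z) < M) ->
  exists t, on_ray s t z.
Proof.
move=> zs left.
have p0 := pi_gt0 R.
have [N _ hN] := left (F (-2) - pi).
pose x k := Re (iter (N + k) fexp z).
have surj n a : exists t : R, iter n F t = a.
  elim: n a => [|n IH] a; first by exists a.
  have [b bE] := Fexp_surj a; have [t tE] := IH b; exists t.
  by rewrite iterS tE.
have mono n : {homo iter n F : u v / u < v}.
  by elim: n => [//|n IH] u v uv; rewrite !iterS; exact/Fexp_lt/IH.
pose p k := xget 0 [set t | iter (N + k) F t = x k].
have pE k : iter (N + k) F (p k) = x k.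
  by apply: (@xgetPex _ 0 [set t | iter (N + k) F t = x k]); exact: surj.
(* So p k and the preimage of x k + pi are the ends of the k-th interval. *)
have leE n u v : (iter n F u <= iter n F v) = (u <= v).
  have [uv|vu] := leP u v; last by apply/negbTE; rewrite -ltNge; exact: mono.
  by move: uv; rewrite le_eqVlt => /predU1P[->|/mono/ltW->//]; rewrite lexx.
have nest k t : x k.+1 <= iter (N + k.+1) F t <= x k.+1 + pi ->
    x k <= iter (N + k) F t <= x k + pi.
  rewrite /x addnS !iterS => h.
  have u2 : iter (N + k) F t <= -2.
    rewrite leNgt; apply/negP => /Fexp_lt.
    by have := hN (N + k.+1)%N (leq_addr _ _); rewrite /= addnS iterS; lra.
  have : iter (N + k) F t - pi <= Re (iter (N + k) fexp z) <= iter (N + k) F t.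
    apply: fexp_window_back u2 _ _ _; first exact: itinerary_strip zs.
      by rewrite -iterS; exact: itinerary_strip zs.
    lra.
  lra.
have nest2 j k t : (j <= k)%N -> x k <= iter (N + k) F t <= x k + pi ->
    x j <= iter (N + j) F t <= x j + pi.
  by move=> /subnK <-; elim: (k - j)%N => [//|d IH]; rewrite addSn => /nest.
pose S := range p.
have inI k : x k <= iter (N + k) F (p k) <= x k + pi by rewrite pE; lra.
have [q qE] := surj N (x 0%N + pi).
have pq k : p k <= q.
  by rewrite -(leE N) qE; have := nest2 0%N k (p k) (leq0n _) (inI k); rewrite addn0 => /andP[].
have supS : has_sup S by split; [exists (p 0%N), 0%N|exists q => _ [k _ <-]].
exists (sup S); apply: (@on_ray_eventually _ _ _ _ N) => // k /subnKC <-.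
set j := (k - N)%N; rewrite /window -/(x j).
have h1 : x j <= iter (N + j) F (sup S).
  by rewrite -(pE j) leE; apply: ub_le_sup; [case: supS|exists j].
suff h2 : iter (N + j) F (sup S) <= x j + pi by lra.
have [v vE] := surj (N + j)%N (x j + pi).
rewrite -vE leE; apply: sup_le_ub; first by case: supS.
move=> _ [l _ <-]; rewrite -(leE (N + j)%N) vE.
have [lj|/ltnW jl] := leqP l j.
  apply: le_trans (_ : x j <= _); last lra.
  rewrite -(pE j) leE -(leE (N + l)%N) pE.
  by have /andP[] := nest2 l j (p j) lj (inI j).
by have /andP[] := nest2 j l (p l) jl (inI l).
Qed.

End DynamicRays.

(** * Continuity of the rays and connectedness of the basin *)

Section ConnectedBasin.
Variable R : realType.
Local Notation C := R[i].
Local Notation F := (@Fexp R).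
Implicit Types (z w : C) (x y t u : R) (n k : nat) (s : nat -> bool).

Lemma trapped_Re_bound z n : trapped z -> `|Re z| <= `|Re (iter n fexp z)| + n%:R * 14.
Proof.
move=> zt; have p2 := pihalf_lt2 R.
elim: n z zt => [|n IH] z zt; first by rewrite mul0r addr0.
rewrite iterSr -natr1 mulrDl mul1r.
have := strip_Re_bound (zt 0%N); have := IH _ (trapped_fexp zt).
have := zt 1%N; rewrite /strip/=; lra.
Qed.

Lemma continuous_iter_Fexp n : continuous (iter n F).
Proof.
elim: n => [|n IH] t; first exact: cvg_id.
by apply: (continuous_comp (IH t)); exact: continuous_Fexp.
Qed.

(** By [compact_separated_cvg]: near [t0] the ray points stay in a box, and a point
    other than [dynamic_ray s t0] violates one of the closed conditions of [on_ray],
    which is then violated for all nearby points and times. *)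
Lemma dynamic_ray_continuous s : continuous (dynamic_ray s : R -> C).
Proof.
move=> t0; have [n nt] := iter_Fexp_cvg t0 (-2).
have p2 := pihalf_lt2 R; have p1 := pi_gt0 R.
have lt_near k m : iter k F t0 < m -> \forall t \near t0, iter k F t < m.
  by move=> h; have /cvgr_lt := @continuous_iter_Fexp k t0; apply.
have gt_near k m : m < iter k F t0 -> \forall t \near t0, m < iter k F t.
  by move=> h; have /cvgr_gt := @continuous_iter_Fexp k t0; apply.
have n2 := nt n (leqnn n).
pose L := `|iter n F t0| + 7 + n%:R * 14.
apply: (@compact_separated_cvg _ _ _ _ _ (box (- L) L (- pi) pi)).
- exact: compact_box.
- have ub := lt_near n _ n2.
  have lb : \forall t \near t0, iter n F t0 - 1 < iter n F t by apply: gt_near; lra.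
  apply: filterS2 ub lb => t ub lb.
  have [zs zw] := dynamic_ray_on_ray s t.
  have zt := itinerary_trapped zs.
  have /andP[w1 w2] := zw n (ltW ub).
  have : `|Re (iter n fexp (dynamic_ray s t))| <= `|iter n F t0| + 7.
    have := ler_norm (- iter n F t0); rewrite normrN ler_norml; lra.
  have := trapped_Re_bound n zt => h1 h2.
  split; last by rewrite -ler_norml; exact: zt 0%N.
  by rewrite -ler_norml /L; lra.
- move=> z _ zr.
  have [hz|/existsNP[k hk]] := pselect (forall k, halfstrip (s k) (iter k fexp z)); last first.
    exists (~` [set z : C | halfstrip (s k) (iter k fexp z)]).
      by apply: open_nbhs_nbhs; split => //; exact/closed_openC/closed_iter_halfstrip.
    apply: nearW => t; have [/(_ k)/Omega_halfstrip tO _] := dynamic_ray_on_ray s t.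
    by move/(_ tO).
  have [wz|/existsNP[k hk]] := pselect (forall k, (n <= k)%N -> window t0 k z).
    case: zr; symmetry; apply/on_rayE; apply: (window_itinerary (ltW n2) hz).
    exact: wz.
  have [nk wk] : (n <= k)%N /\ ~ window t0 k z by apply/not_implyP.
  have k2 := nt k nk.
  pose x := Re (iter k fexp z).
  have cx m : x < m -> \forall w \near z, Re (iter k fexp w) < m.
    have : {for z, continuous (fun w : C => Re (iter k fexp w))}.
      by apply: continuous_comp; [exact: continuous_iter_fexp|exact: continuous_Re].
    by move=> /cvgr_lt h xm; apply: h.
  have cx' m : m < x -> \forall w \near z, m < Re (iter k fexp w).
    have : {for z, continuous (fun w : C => Re (iter k fexp w))}.
      by apply: continuous_comp; [exact: continuous_iter_fexp|exact: continuous_Re].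
    by move=> /cvgr_gt h xm; apply: h.
  have [xlo|xlo] := ltP x (iter k F t0 - pi).
    pose m := (x + (iter k F t0 - pi)) / 2.
    exists [set w : C | Re (iter k fexp w) < m]; first by apply: cx; rewrite /m; lra.
    have g : \forall t \near t0, m + pi < iter k F t by apply: gt_near; rewrite /m; lra.
    have l := lt_near k _ k2.
    apply: filterS2 l g => t l g /= h.
    have [_ /(_ k (ltW l)) /andP[]] := dynamic_ray_on_ray s t; lra.
  have xhi : iter k F t0 < x.
    by rewrite ltNge; apply/negP => xhi; apply: wk; rewrite /window xlo.
  pose m := (x + iter k F t0) / 2.
  exists [set w : C | m < Re (iter k fexp w)]; first by apply: cx'; rewrite /m; lra.
  have g : \forall t \near t0, iter k F t < m by apply: lt_near; rewrite /m; lra.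
  have l := lt_near k _ k2.
  apply: filterS2 l g => t l g /= h.
  have [_ /(_ k (ltW l)) /andP[]] := dynamic_ray_on_ray s t; lra.
Qed.

Definition seg z w : set C :=
  (fun t : R => (Re z + t * (Re w - Re z)) +i* (Im z + t * (Im w - Im z))) @` `[0, 1].

Lemma seg_connected z w : connected (seg z w).
Proof.
apply: connected_continuous_connected; first exact: segment_connected.
apply: continuous_subspaceT => t; apply: continuous_complex => /=.
  by apply: cvgD; [exact: cvg_cst|apply: cvgMl; exact: cvg_id].
by apply: cvgD; [exact: cvg_cst|apply: cvgMl; exact: cvg_id].
Qed.

Lemma seg_component (A : set C) z w : seg z w `<=` A -> connected_component A z w.
Proof.
move=> sA; exists (seg z w); last first.
  by exists 1; rewrite /= ?in_itv/= ?ler01 ?lexx// !mul1r; apply: complexP => /=; ring.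
split => //; last exact: seg_connected.
by exists 0; rewrite /= ?in_itv/= ?ler01 ?lexx// !mul0r !addr0; apply: complexP.
Qed.

Definition obox z (e : R) : set C :=
  [set w | `|Re w - Re z| < e /\ `|Im w - Im z| < e].

Lemma obox_seg z e w : obox z e w -> seg z w `<=` obox z e.
Proof.
move=> [w1 w2] _ [t + <-]; rewrite /= in_itv/= => /andP[t0 t1].
rewrite /obox/= ![_ + _ * _]addrC !addrK !normrM ger0_norm//.
by split; [apply: le_lt_trans w1|apply: le_lt_trans w2]; rewrite ler_piMl.
Qed.

Lemma obox_component (A : set C) z e w : obox z e `<=` A -> obox z e w ->
  connected_component A z w.
Proof.
by move=> eA ew; apply: seg_component => v /(obox_seg ew); exact: eA.
Qed.

Lemma obox_nbhs z (e : R) : 0 < e -> nbhs z (obox z e).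
Proof. by move=> e0; apply/nbhs_complexP; exists e. Qed.

Lemma nbhs_obox z A : nbhs z A -> exists2 e : R, 0 < e & obox z e `<=` A.
Proof. by move=> /nbhs_complexP[e e0 h]; exists e => // w [w1 w2]; exact: h. Qed.

(** The plane minus [1, +oo[, on whose intersection with S both inverse
    branches are defined. *)
Definition slit : set C := [set w | Im w = 0 -> Re w < 1].

Lemma real_basin z : Im z = 0 -> basin z.
Proof.
move=> y0; apply: (@basinP _ _ 1%N); last by apply: real_core; rewrite y0 ?sin0 ?cos0.
move=> j; case: j => [|[|//]] _; rewrite /strip/= ?Im_fexp y0 ?sin0 ?mulr0 ?subr0;
  by rewrite normr0 pi_ge0.
Qed.

(** The preimage of the real axis in the half-strip [i] is the curve
    exp(-x) = y / sin y, which ends at the critical point 0. *)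
Lemma real_preimage_small i (e : R) : 0 < e ->
  exists z, [/\ Omega i z, Im (fexp z) = 0 & obox 0 e z].
Proof.
move=> e0; pose y := Num.min (1 / 2) (e / 2).
have y0 : 0 < y by rewrite lt_min; apply/andP; split; lra.
have y1 : y <= 1 / 2 by rewrite ge_min lexx.
have y2 : y <= e / 2 by rewrite ge_min lexx orbT.
have p2 := pi_ge2 R.
have s0 : 0 < sin y by apply: sin_gt0_pi; lra.
have sy := sin_ltx y0.
have := sub_sin_le y; rewrite (gtr0_norm y0) ger0_norm ?subr_ge0 ?(ltW sy)// => s3.
pose x := - ln (y / sin y).
have q0 : 0 < y / sin y by rewrite divr_gt0.
have q1 : 1 <= y / sin y by rewrite ler_pdivlMr// mul1r ltW.
have x0 : x <= 0 by rewrite oppr_le0 ln_ge0.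
have xy : - y <= x.
  rewrite lerN2; apply: le_trans (_ : y / sin y - 1 <= _).
    have -> : ln (y / sin y) = ln (1 + (y / sin y - 1)) by congr ln; ring.
    by apply: le_ln1Dx; lra.
  rewrite lerBlDl ler_pdivrMr//.
  have yy : y ^+ 2 <= y * (1 / 2) by rewrite expr2 ler_wpM2l// ltW.
  have y3 : y ^+ 3 <= y ^+ 2 * (1 / 2) by rewrite exprSr ler_wpM2l// sqr_ge0.
  have y4 : (1 + y) * (y - y ^+ 3) <= (1 + y) * sin y by rewrite ler_wpM2l//; lra.
  have y5 : y ^+ 4 <= y ^+ 3 * (1 / 2) by rewrite exprSr ler_wpM2l// exprn_ge0// ltW.
  have : (1 + y) * (y - y ^+ 3) = y + y ^+ 2 - y ^+ 3 - y ^+ 4 by ring.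
  have := sqr_ge0 y; lra.
have zO : Omega i (vpoint i x y) by apply/OmegaE; rewrite height_vpoint; lra.
exists (vpoint i x y); split => //.
  apply/(height_real i); rewrite height_fexp height_vpoint /= /x opprK lnK ?posrE//.
  by rewrite divfK ?gt_eqF// subrr.
rewrite /obox/= !subr0; split; first by rewrite ler0_norm//; lra.
by case: i {zO}; rewrite ?normrN gtr0_norm//; lra.
Qed.

Lemma slit_basin_branch i w : basin w -> slit w -> branch_domain i w.
Proof. by move=> [wt _] ws; split => //; exact/strip_height/(wt 0%N). Qed.

Lemma phi_basin i w : basin w -> slit w -> basin (phi i w) /\ slit (phi i w).
Proof.
move=> wb ws; have [pO pE] := phiP (slit_basin_branch i wb ws).
split; last by move/(Omega_nonreal pO).
by apply: fexp_basin; [exact: halfstrip_strip (Omega_halfstrip pO)|rewrite pE].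
Qed.

Lemma phi_image_component i v w : connected_component (@basin R `&` slit) v w ->
  connected_component (@basin R `&` slit) (phi i v) (phi i w).
Proof.
move=> [S [Sv SA cS] Sw].
exists (phi i @` S); last by exists w.
split; first by exists v.
  by move=> _ [u /SA[ub us] <-]; exact: phi_basin.
apply: connected_continuous_connected => //.
apply/subspace_continuousP => u Su A nA.
have [ub us] := SA u Su.
have h : \forall v \near u, branch_domain i v -> A (phi i v).
  exact: (phi_continuous (slit_basin_branch i ub us) nA).
change (\forall v \near u, S v -> A (phi i v)).
apply: filterS h => u' h Su'; apply: h.
by have [ub' us'] := SA u' Su'; exact: slit_basin_branch.
Qed.

(** Convexity: the segment to 0 stays in the core. *)
Lemma core_star z : core z -> strip z -> slit z ->
  connected_component (@basin R `&` slit) 0 z.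
Proof.
move=> [x0 c0] zS zs; apply: seg_component => w [t + <-].
rewrite /= in_itv/= !subr0 !add0r => /andP[t0 t1].
have [->|tn0] := eqVneq t 0.
  by rewrite !mul0r; split; [exact: real_basin|].
have {}t0 : 0 < t by rewrite lt_neqAle eq_sym tn0.
have p1 := pi_gt0 R.
have yp : `|Im z| < pi / 2.
  rewrite ltNge; apply/negP => h; move: c0; rewrite -cos_norm ltNge => /negP; apply.
  rewrite -cos_pihalf; move: h; rewrite le_eqVlt => /predU1P[->//|h].
  by apply: ltW; rewrite ltr_cos ?in_itv/= ?normr_ge0//; lra.
have ty : `|t * Im z| < pi / 2.
  by apply: le_lt_trans yp; rewrite normrM gtr0_norm// ler_piMl.
split.
  apply: (@basinP _ _ 0%N) => /=.
    by move=> j; rewrite leqn0 => /eqP ->; rewrite /strip/=; lra.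
  rewrite /core/= mulr_gt0//; split => //.
  by apply: cos_gt0_pihalf; rewrite -ltr_norml.
move=> /= /eqP; rewrite mulf_eq0 (gt_eqF t0) /= => /eqP/zs z1.
have : t * Re z <= 1 * Re z by rewrite ler_wpM2r// ltW.
lra.
Qed.

Lemma real_component z : Im z = 0 -> Re z < 1 ->
  connected_component (@basin R `&` slit) 0 z.
Proof.
move=> y0 x1; apply: seg_component => w [t + <-].
rewrite /= in_itv/= !subr0 !add0r y0 mulr0 => /andP[t0 t1].
split; first exact: real_basin.
move=> _ /=; have [x0|x0] := leP 0 (Re z).
  have : t * Re z <= 1 * Re z by rewrite ler_wpM2r.
  lra.
have : t * Re z <= 0 by rewrite mulr_ge0_le0// ltW.
lra.
Qed.

(** The image of ]-oo, 1[ under the branch accumulates at 0 by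
    [real_preimage_small], so it meets a small box around 0 in the basin. *)
Lemma phi_real_component i :
  connected_component (@basin R `&` slit) 0 (phi i 0).
Proof.
have b0 : basin (0 : C) by exact: real_basin.
have [e1 e10 he1] := nbhs_obox (open_nbhs_nbhs (conj (@open_basin R) b0)).
(* A box of size 1 / 2 also avoids the slit. *)
pose e := Num.min (1 / 2) e1.
have e0 : 0 < e by rewrite lt_min e10 andbT; lra.
have [z [zO z0 ze]] := real_preimage_small i e0.
apply: (@connected_component_trans _ _ z).
  apply: obox_component ze => w [/= w1 w2]; split.
    apply: he1; split; [apply: lt_le_trans w1 _|apply: lt_le_trans w2 _];
      by rewrite ge_min lexx orbT.
  move=> _; have : `|Re w - 0| < 1 / 2 by apply: lt_le_trans w1 _; rewrite ge_min lexx.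
  by rewrite subr0 ltr_norml; lra.
rewrite -(phi_eq zO erefl); apply: connected_component_sym.
apply: phi_image_component; apply: real_component => //.
by have [_] := Omega_branch_domain zO; apply.
Qed.

(** Induction on the time of entry in the core.  The branch maps a connected set
    from 0 to f(z) onto a connected set from [phi i 0] to z, and [phi i 0] is joined
    to 0 by [phi_real_component].  The slit is avoided so as to stay in the domain of
    the branches. *)
Lemma basin_slit_component z : basin z -> slit z ->
  connected_component (@basin R `&` slit) 0 z.
Proof.
move=> zb zs; have [zt [n zc]] := zb.
elim: n z zb zs zt zc => [|n IH] z zb zs zt zc.
  by apply: core_star => //; exact: (zt 0%N).
have [y0|y0] := eqVneq (Im z) 0; first by apply: real_component => //; exact: zs.
have [i zi] := strip_halfstrip (zt 0%N).
have zO : Omega i z by apply: halfstrip_Omega zi _; exact/eqP.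
have [_ fs] := Omega_branch_domain zO.
apply: (@connected_component_trans _ _ (phi i 0)); first exact: phi_real_component.
rewrite -(phi_eq zO erefl); apply: phi_image_component; apply: IH => //.
- exact: basin_fexp.
- exact: trapped_fexp.
- by rewrite -iterSr.
Qed.

Lemma connected_component_le (A B : set C) z w : A `<=` B ->
  connected_component A z w -> connected_component B z w.
Proof.
by move=> AB [S [Sz SA cS] Sw]; exists S => //; split=> // u /SA/AB.
Qed.

Lemma basin_component z : basin z -> connected_component (@basin R) 0 z.
Proof.
move=> zb; have [zs|zs] := pselect (slit z).
  by apply: connected_component_le (basin_slit_component zb zs) => w [].
have y0 : Im z = 0 by apply: contrapT => y0; apply: zs => /y0.
apply: seg_component => w [t _ <-]; apply: real_basin.
by rewrite /= y0 !subr0 mulr0 addr0.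
Qed.

End ConnectedBasin.

(** * The basin in the Fatou set, and orbits modulo the period of the exponential *)

Section Fatou.
Variable R : realType.
Local Notation C := R[i].
Implicit Types (z w : C) (x y t u : R) (n k : nat) (U V : set C).

Lemma extraction (P : nat -> nat -> Prop) :
  (forall j N, exists2 n, (N <= n)%N & P j n) ->
  exists2 k : nat -> nat, {homo k : m n / (m < n)%N} & forall j, P j (k j).
Proof.
move=> h.
have /choice[g gP] : forall jN : nat * nat, exists n, (jN.2 <= n)%N /\ P jN.1 n.
  by move=> [j N]; have [n n1 n2] := h j N; exists n.
pose k := fix k j := if j is j'.+1 then g (j, (k j').+1) else g (0%N, 0%N).
exists k; last by case=> [|j]; [exact: (gP (0%N, 0%N)).2|exact: (gP (j.+1, (k j).+1)).2].
apply: homo_ltn; first exact: ltn_trans.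
by move=> j; exact: (gP (j.+1, (k j).+1)).1.
Qed.

Lemma basin_locally_uniform z : basin z -> exists2 W, nbhs z W &
  forall M : R, \forall n \near \oo, forall w, W w -> M < Re (iter n fexp w).
Proof.
move=> [_ [n0 [x0 c0]]].
pose c := cos (Im (iter n0 fexp z)) / 2.
have cp : 0 < c by rewrite divr_gt0.
exists [set w | core (iter n0 fexp w) /\ c < cos (Im (iter n0 fexp w))].
  apply: filterI.
    by apply: continuous_iter_fexp; apply: open_nbhs_nbhs; split; [exact: open_core|].
  have : {for z, continuous (fun w : C => cos (Im (iter n0 fexp w)))}.
    apply: (continuous_comp (f := fun w : C => Im (iter n0 fexp w))); last exact: continuous_cos.
    by apply: continuous_comp; [exact: continuous_iter_fexp|exact: continuous_Im].
  by move=> /cvgr_gt; apply; rewrite /c; lra.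
move=> M; have [N hN] := core_escape M cp.
exists (N + n0)%N => // n /= nN w [wc wc2].
rewrite -(@subnK n0 n) ?iterD; last exact: leq_trans (leq_addl _ _) nN.
by apply: hN => //; [rewrite leq_subRL ?(leq_trans (leq_addl _ _) nN)// addnC|exact: ltW].
Qed.

(** Either one exponent occurs infinitely often in a sequence of iterates, which
    gives a constant subsequence, or the exponents tend to oo along a subsequence,
    and the iterates tend to oo locally uniformly. *)
Lemma basin_normal : normal_family (@basin R) (range (fun n => iter n fexp)).
Proof.
move=> h hr.
have /choice[m mE] : forall n, exists m, iter m fexp = h n.
  by move=> n; have [m _ mE] := hr n; exists m.
have [[M hM]|nM] := pselect (exists M, forall N, exists2 n, (N <= n)%N & m n = M).
  have [k km kM] := extraction (fun _ => hM); exists k => //.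
  left; exists (iter M fexp) => z zb; exists setT; first exact: filterT.
  have -> : h \o k = fun _ => iter M fexp.
    by apply/funext => j; rewrite /= -mE kM.
  by move=> A nA; exists 0%N => // n _; exact: nbhs_singleton nA.
have mfin M : exists N, forall n, (N <= n)%N -> m n <> M.
  apply: contrapT => H; apply: nM; exists M => N; apply: contrapT => HN.
  by apply: H; exists N => n Nn mM; apply: HN; exists n.
have mge j : exists N, forall n, (N <= n)%N -> (j <= m n)%N.
  elim: j => [|j [N IH]]; first by exists 0%N.
  have [N' h'] := mfin j; exists (maxn N N') => n; rewrite geq_max => /andP[n1 n2].
  by rewrite ltn_neqAle IH// andbT; apply/eqP => e; apply: (h' n n2).
have [|k km kM] := @extraction (fun j n => (j <= m n)%N).
  by move=> j N; have [N' h'] := mge j; exists (maxn N N'); rewrite ?leq_maxl// h'// leq_maxr.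
exists k => //; right => z zb.
have [W zW hW] := basin_locally_uniform zb; exists W => // M.
have [N _ hN] := hW M; exists N => // n /= Nn w [Ww _].
rewrite -mE; apply: lt_le_trans (ler_Re_normc _).
by apply: lt_le_trans (ler_norm _); apply: hN => //=; exact: leq_trans Nn (kM n).
Qed.

Lemma basin_fatou : @basin R `<=` fatou_set fexp.
Proof.
by move=> z zb; exists (@basin R); [split => //; exact: open_basin|exact: basin_normal].
Qed.

Lemma fatou_component_open U : fatou_component fexp U -> open U.
Proof.
move=> [z0 _ ->]; rewrite openE => z zU; rewrite /interior.
have [V [oV Vz] nV] := connected_component_sub zU.
have [e e0 eV] := nbhs_obox (open_nbhs_nbhs (conj oV Vz)).
apply: filterS (obox_nbhs z e0) => w ew.
apply: connected_component_trans zU _.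
apply: obox_component ew => v /eV Vv; by exists V.
Qed.

Lemma fatou_component_full U A : fatou_component fexp U -> A `<=` fatou_set fexp ->
  forall z w, U z -> connected_component A z w -> U w.
Proof.
move=> [z0 _ ->] AF z w Uz zw; apply: connected_component_trans Uz _.
exact: connected_component_le zw.
Qed.

(** The half-open interval matters: it excludes the line Im = -pi, so that a point
    on a line Im = pi mod 2 pi always gets the same symbol as its image. *)
Lemma reduce_Im y : exists k : int, - pi < y - k%:~R * (2 * pi) <= pi.
Proof.
have p0 := pi_gt0 R; have q0 : 0 < 2 * pi :> R by lra.
pose q := (y - pi) / (2 * pi).
exists (Num.ceil q).
have h1 := ceil_ge q; have h2 := gt_pred_ceil q.
have e : y - pi = q * (2 * pi) by rewrite divfK// gt_eqF.
have h3 : q * (2 * pi) <= (Num.ceil q)%:~R * (2 * pi) by rewrite ler_pM2r.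
have h4 : ((Num.ceil q)%:~R - 1) * (2 * pi) < q * (2 * pi).
  by rewrite ltr_pM2r//; move: h2; rewrite intrD; lra.
by apply/andP; split; lra.
Qed.

Lemma twistD (k l : int) : twist R (k + l) = twist R k + twist R l.
Proof. by apply: complexP; rewrite ?ReD ?ImD /= ?addr0// -mulrDl intrD. Qed.

(** The sign condition on the translations follows by comparing heights: the image
    of the half-strip lies below its outer line, and representatives are in
    ]-pi, pi]. *)
Lemma noncore_pseudo_orbit z : (forall n, ~ core (iter n fexp z)) ->
  exists (k : nat -> int) i m, pseudo_orbit (fun n => iter n fexp z - twist R (k n)) i m.
Proof.
move=> nc; have p0 := pi_gt0 R.
have /choice[k kP] : forall n, exists k : int,
    - pi < Im (iter n fexp z) - k%:~R * (2 * pi) <= pi by move=> n; exact: reduce_Im.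
pose a n := iter n fexp z - twist R (k n).
have aE n : a n + twist R (k n) = iter n fexp z by rewrite subrK.
have Ia n : - pi < Im (a n) <= pi by rewrite ImB; exact: kP.
have ncz n : ~ core (a n) by move=> /(core_twist _ (k n)); rewrite aE; exact: nc.
have fE n : fexp (a n) = a n.+1 + twist R (k n.+1 - k n).
  by rewrite twistD addrA aE iterS -[in RHS]aE fexp_twist -addrA -twistD subrr twist0 addr0.
have ncf n : ~ core (fexp (a n)).
  by rewrite fE => /core_twist; exact: ncz.
have a0 n : Im (a n) <> 0 by move=> y0; apply: (@ncf n); apply: real_core; rewrite y0 ?sin0 ?cos0.
exists k, (fun n => Im (a n) < 0), (fun n => k n.+1 - k n) => n.
have aO : Omega (Im (a n) < 0) (a n).
  apply/OmegaE; rewrite /height; have := a0 n; have := Ia n.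
  by case: (ltgtP (Im (a n)) 0) => // h1 /andP[h2 h3] _; apply/andP; split => //; lra.
split => //; [by apply: contrapT => /not_expanding_core; exact: ncf|exact: fE|].
have [d1 _] := Omega_branch_domain aO.
have hf := height_fexp (Im (a n) < 0) (a n).
have Imf : Im (fexp (a n)) = Im (a n.+1) + (k n.+1 - k n)%:~R * (2 * pi) by rewrite fE ImD.
have b1 := Ia n.+1; have b0 := Ia n.
move/OmegaE: aO d1 hf; rewrite /height /=; case: (Im (a n) < 0) => aO d1 hf.
  have s0 : 0 < sin (- Im (a n)) by apply: sin_gt0_pi; lra.
  have := mulr_gt0 (expR_gt0 (- Re (a n))) s0 => es.
  have : -1 * (2 * pi) < (k n.+1 - k n)%:~R * (2 * pi) :> R by lra.
  rewrite ltr_pM2r; last lra.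
  rewrite -[-1]/((-1)%:~R : R) ltr_int => k1.
  by rewrite oppr_le0 mulr_ge0//; [rewrite ler0z; lia|lra].
have : (k n.+1 - k n)%:~R * (2 * pi) < 1 * (2 * pi) :> R by lra.
rewrite ltr_pM2r; last lra.
rewrite -[X in _ < X]/(1%:~R : R) ltr_int => k1.
by rewrite mulr_le0_ge0//; [rewrite lerz0; lia|lra].
Qed.

End Fatou.

(** * The Baker domain is the basin *)

Section BakerDomain.
Variable R : realType.
Local Notation C := R[i].
Implicit Types (z w : C) (x y t u : R) (n k p : nat) (U V : set C).

Lemma iter_period U p j z : iter p fexp @` U `<=` U -> U z -> U (iter (j * p) fexp z).
Proof.
move=> Up; elim: j z => [//|j IH] z Uz.
by rewrite mulSn iterD; apply: Up; exists (iter (j * p) fexp z) => //; exact: IH.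
Qed.

(** If U missed the basin, no orbit from U would meet the translates of the core: at
    the next multiple of the period it would be in S, hence in the basin.  So orbits
    from U are pseudo-orbits, and [pullback_core] gives points of U that reach the
    core, a contradiction. *)
Lemma baker_meets_basin U : baker_domain fexp U -> U `<=` strip ->
  exists z, U z /\ basin z.
Proof.
move=> [fU [p p0 Up] _] US; have oU := fatou_component_open fU.
have [z0 Fz0 UE] := fU.
have Uz0 : U z0 by rewrite UE; exact: connected_component_refl.
apply: contrapT => nB.
have nc z n : U z -> ~ core (iter n fexp z).
  move=> Uz zc; apply: nB; exists (iter (n * p) fexp z).
  split; first exact: iter_period.
  apply: (@basinP _ _ 0%N) => [j|/=]; last by apply: iter_core_ge zc; rewrite leq_pmulr.
  by rewrite leqn0 => /eqP ->; apply: US; exact: iter_period.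
have [k [i [m po]]] := noncore_pseudo_orbit (fun n => @nc z0 n Uz0).
have [e e0 eU] := nbhs_normc (open_nbhs_nbhs (conj oU Uz0)).
have [w [n [we wc]]] := pullback_core po e0.
have Uw : U (w + twist R (k 0%N)).
  by apply: eU; move: we; rewrite /= opprB addrA addrAC.
apply: (nc _ n Uw).
have -> : iter n fexp (w + twist R (k 0%N)) = iter n fexp w + twist R (k 0%N).
  by elim: (n) => [//|n' IH]; rewrite !iterS IH fexp_twist.
exact/core_twist.
Qed.

(** It remains to see that the basin is closed in U.  If z in U is in its closure
    and in the limit set, join z to a nearby point w of the basin by a segment: for
    large multiples n of the period, the n-th iterate has modulus at least 5 on the
    segment and maps it into S, so its real part does not vanish there; but it is
    negative at z and positive at w. *)
Lemma baker_domain_basin U : baker_domain fexp U -> U `<=` strip -> U = @basin R.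
Proof.
move=> bU US; have [z1 [Uz1 bz1]] := baker_meets_basin bU US.
have [fU [p p0 Up] luU] := bU.
have oU := fatou_component_open fU.
have BU : @basin R `<=` U.
  move=> w wb; apply: (fatou_component_full fU (@basin_fatou R) Uz1).
  by apply: connected_component_trans (connected_component_sym (basin_component bz1)) _; exact: basin_component.
have cU : connected U by case: fU => z0 _ ->; exact: component_connected.
apply/esym; apply: cU; first by exists z1.
  by exists (@basin R); [exact: open_basin|rewrite setIidr].
exists (closure (@basin R)); first exact: closed_closure.
apply/seteqP; split => [w wb|z [Uz zc]].
  by split; [exact: BU|exact: subset_closure].
apply: contrapT => zb.
have zL : limit_set z by rewrite -boundary_basin /boundary; have /interior_id -> := @open_basin R.
have [W zW hW] := luU z Uz.
have [e e0 eW] := nbhs_obox (filterI zW (open_nbhs_nbhs (conj oU Uz))).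
have esc M : \forall n \near \oo, M < normc (iter n fexp z).
  have [N _ hN] := hW M; exists N => // n /hN; apply.
  by apply: eW; rewrite /obox/= !subrr normr0.
have [w [wb we]] := zc _ (obox_nbhs z e0).
have [N1 _ h1] := limit_set_escape_left zL esc 0.
have [Wb wWb hWb] := basin_locally_uniform wb.
have [N2 _ h2] := hWb 0.
have [N3 _ h3] := hW 5.
pose N := maxn N1 (maxn N2 N3); pose n := (N * p)%N.
have nN : (N <= n)%N by rewrite leq_pmulr.
have n1 : (N1 <= n)%N by apply: leq_trans nN; rewrite leq_maxl.
have n2 : (N2 <= n)%N by apply: leq_trans nN; rewrite !leq_max leqnn orbT.
have n3 : (N3 <= n)%N by apply: leq_trans nN; rewrite !leq_max leqnn !orbT.
have zlt : Re (iter n fexp z) < 0 by exact: h1.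
have wgt : 0 < Re (iter n fexp w) by apply: h2 => //; exact: nbhs_singleton wWb.
pose g (v : C) := Re (iter n fexp v).
have cg : continuous g.
  by move=> v; apply: continuous_comp; [exact: continuous_iter_fexp|exact: continuous_Re].
have /connected_intervalP cI : connected (g @` seg z w).
  apply: connected_continuous_connected; first exact: seg_connected.
  exact: continuous_subspaceT cg.
have zs : seg z w z.
  by exists 0; rewrite /= ?in_itv/= ?ler01 ?lexx// !mul0r !addr0; apply: complexP.
have ws : seg z w w.
  by exists 1; rewrite /= ?in_itv/= ?ler01 ?lexx// !mul1r; apply: complexP => /=; ring.
have [|||v vs v0] := cI (g z) (g w) _ _ 0; [by exists z|by exists w|by rewrite !ltW|].
have /eW [Wv Uv] := obox_seg we vs.
have := h3 n n3 v (conj Wv Uv); rewrite ltNge => /negP; apply.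
apply: le_trans (ler_normc _) _; rewrite [Re _]v0 normr0 add0r.
have : strip (iter n fexp v) by apply: US; exact: iter_period.
by rewrite /strip/=; have := pihalf_lt2 R; lra.
Qed.

End BakerDomain.

(** * The limit set as a closure of rays *)

Section Conclusion.
Variable R : realType.
Local Notation C := R[i].

Lemma closed_limit_set : closed (@limit_set R).
Proof.
rewrite /limit_set setDE; apply: closedI; first exact: closed_trapped.
by apply: open_closedC; exact: open_basin.
Qed.

Lemma left_escaping (z : C) :
  (forall M : R, \forall n \near \oo, Re (iter n fexp z) < M) ->
  escaping_set fexp z.
Proof.
move=> h; apply/cvgryPgt => A.
apply: filterS (h (- `|A|)) => n x.
apply: lt_le_trans (ler_Re_normc _); apply: le_lt_trans (ler_norm A) _.
by rewrite ltr_normr ltrNr x orbT.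
Qed.

Lemma limit_set_closure_rays :
  @limit_set R = closure (\bigcup_(s : nat -> bool) range (dynamic_ray s)).
Proof.
apply/seteqP; split => z.
  move=> zL A /nbhs_normc[e e0 eA].
  have [w [s [N [we ws [i hN]]]]] := limit_set_line_approx zL e0.
  exists w; split; last exact: eA.
  have [|t /on_rayE wt] := itinerary_left_on_ray ws; last by exists s => //; exists t.
  move=> M; have [n hn] := iter_Fexp_cvg (Re (iter N fexp w)) M.
  exists (n + N)%N => // k /= nk.
  have kN : (N <= k)%N := leq_trans (leq_addl _ _) nk.
  rewrite -(subnK kN) iterD (line_Re_iter (k - N) hN).1.
  by apply: hn; rewrite leq_subRL// addnC.
move=> zc; apply: closed_limit_set; apply: closure_subset zc => w [s _ [t _ <-]].
exact: on_ray_limit_set (dynamic_ray_on_ray s t).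
Qed.

End Conclusion.

Theorem theoremA (R : realType) (U : set R[i])
    (U_baker : baker_domain fexp U) (U_sub_S : U `<=` strip) :
  [/\ (* every dynamic ray is a curve of escaping boundary points, tending to
         infinity as t tends to -oo *)
      forall s : nat -> bool,
        [/\ continuous (dynamic_ray s : R -> R[i]),
            range (dynamic_ray s) `<=` boundary U `&` escaping_set fexp &
            Normc.normc (dynamic_ray s t : R[i]) @[t --> -oo] --> +oo],
      (* every escaping boundary point lies on exactly one dynamic ray *)
      forall z : R[i], (boundary U `&` escaping_set fexp) z ->
        exists! s : nat -> bool, range (dynamic_ray s) z &
      boundary U = closure (\bigcup_(s : nat -> bool) range (dynamic_ray s))].
Proof.
rewrite (baker_domain_basin U_baker U_sub_S) boundary_basin; split.
- move=> s; split; first exact: dynamic_ray_continuous.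
    move=> _ [t _ <-]; have zt := dynamic_ray_on_ray s t; split.
      exact: on_ray_limit_set zt.
    by apply: left_escaping => M; exact: on_ray_left zt.
  apply/cvgryPgt => A; exists (Num.min (-2) (- `|A|)).
  split => [|t]; first exact: num_real.
  rewrite lt_min => /andP[t2 tA].
  have [_ /(_ 0%N (ltW t2)) /andP[_ /= x]] := dynamic_ray_on_ray s t.
  apply: lt_le_trans (ler_Re_normc _); apply: le_lt_trans (ler_norm A) _.
  by rewrite ltr_normr ltrNr (le_lt_trans x tA) orbT.
- move=> z [zL /cvgryPgt esc]; have [s zs] := limit_set_itinerary zL.
  have [t /on_rayE zt] := itinerary_left_on_ray zs (limit_set_escape_left zL esc).
  exists s; split; first by exists t.
  by move=> s' [t' _ /on_rayE[zs' _]]; exact: itinerary_inj zs zs'.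
- exact: limit_set_closure_rays.
Qed.
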